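(* Suppose the probability space $(\Omega,\mathcal{A},\mathbf{P})$ is complete. Let $S_2:\mathbb{R}\to\mathbb{R}$ and $r>0$. Then $S_2$ is the specific covariogram of a stationary random closed set $Z\subset\mathbb{R}$ such that $\mathbf{E}\,\mathcal{H}^0(\partial Z\cap(0,1))\le r$ if and only if $S_2$ is $\mathcal{F}$-specific covariogram admissible and Lipschitz with Lipschitz constant $L\le r/2$.
   Context: A random closed set (RACS) is a map $Z:\Omega\to\mathcal{F}$ (closed subsets of $\mathbb{R}$) with $\{Z\cap K\ne\emptyset\}\in\mathcal{A}$ for every compact $K$; it is stationary if its law is translation invariant. Its specific covariogram is $y\mapsto\mathbf{E}\,\mathcal{L}^1(Z\cap(y+Z)\cap(0,1))$. $\mathcal{H}^0$ is counting measure and $\partial Z$ the topological boundary. Let $\mathcal{W}$ be the bounded open $W\subset\mathbb{R}$ with $\mathcal{L}^1(\partial W)=0$ and $\delta_{y;W}(F)=\mathcal{L}^1(F\cap(y+F)\cap W)$. $S_2$ is $\mathcal{F}$-specific covariogram admissible if for all $q\ge1$, $a\in\mathbb{R}^q$, $y_i\in\mathbb{R}$, $W_i\in\mathcal{W}$, $c\in\mathbb{R}$: $[c+\sum_ia_i\delta_{y_i;W_i}(F)\ge0$ for all closed $F\subset\mathbb{R}]\Rightarrow c+\sum_ia_iS_2(y_i)\mathcal{L}^1(W_i)\ge0$.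
   Formalization: The probability space is additionally assumed to carry a random variable uniform on [0,1]; without this the ''if'' part fails, e.g. on a one-point space with S_2 constantly 1/2, where the only stationary closed sets are ∅ and ℝ. *)

(* Defs.v *)
From HB Require Import structures.
From mathcomp Require Import all_boot all_order all_algebra.
From mathcomp Require Import all_classical all_reals all_analysis.
Set Implicit Arguments. Unset Strict Implicit. Unset Printing Implicit Defensive.
Import Order.TTheory GRing.Theory Num.Theory.
Import numFieldNormedType.Exports.
Local Open Scope classical_set_scope.
Local Open Scope ring_scope.

Section defs.
Context {R : realType}.

Definition translate (y : R) (F : set R) : set R := [set y + x | x in F].

Definition boundary (A : set R) : set R := closure A `\` interior A.

Definition fell_gen : set (set (set R)) :=
  [set [set F : set R | F `&` K !=set0] | K in [set K : set R | compact K]].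

Definition fell_measurable : set (set (set R)) := <<s fell_gen >>.

Definition complete_prob {d} {Omega : measurableType d}
  (P : probability Omega R) : Prop :=
  forall N : set Omega, measurable N -> P N = 0%E ->
  forall A, A `<=` N -> measurable A.

Definition RACS {d} {Omega : measurableType d} (Z : Omega -> set R) : Prop :=
  (forall w, closed (Z w)) /\
  (forall K : set R, compact K -> measurable [set w | Z w `&` K !=set0]).

Definition stationary {d} {Omega : measurableType d}
  (P : probability Omega R) (Z : Omega -> set R) : Prop :=
  forall (y : R) (B : set (set R)), fell_measurable B ->
    P [set w | B (Z w)] = P [set w | B (translate y (Z w))].

Definition specific_covariogram {d} {Omega : measurableType d}
  (P : probability Omega R) (Z : Omega -> set R) (y : R) : \bar R :=
  (\int[P]_w (@lebesgue_measure R) (Z w `&` translate y (Z w) `&` `]0%R, 1%R[))%E.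

Definition class_W (W : set R) : Prop :=
  bounded_set W /\ open W /\ (@lebesgue_measure R) (boundary W) = 0%E.

(** delta_{y;W}(F) = L^1(F ∩ (y+F) ∩ W) (finite since W is bounded) *)
Definition delta (y : R) (W F : set R) : R :=
  fine ((@lebesgue_measure R) (F `&` translate y F `&` W)).

Definition F_scov_admissible (S2 : R -> R) : Prop :=
  forall (q : nat), (1 <= q)%N ->
  forall (a : 'I_q -> R) (y : 'I_q -> R) (W : 'I_q -> set R) (c : R),
    (forall i, class_W (W i)) ->
    (forall F : set R, closed F -> 0 <= c + \sum_(i < q) a i * delta (y i) (W i) F) ->
    0 <= c + \sum_(i < q) a i * S2 (y i) * fine ((@lebesgue_measure R) (W i)).

Definition lipschitz_with (L : R) (f : R -> R) : Prop :=
  forall x y : R, `|f x - f y| <= L * `|x - y|.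

Definition carries_uniform {d} {Omega : measurableType d}
  (P : probability Omega R) : Prop :=
  exists U : Omega -> R, measurable_fun setT U /\
    forall t : R, 0 <= t <= 1 -> P [set w | U w <= t] = t%:E.

End defs.

(* Main.v *)
(** If [Z] is stationary, Tonelli gives [E L^1(Z n (y+Z) n W) = P(0, -y \in Z) L^1(W)],
    whence admissibility. Moreover [|S2 a - S2 b| <= S2 0 - S2 (b - a)], which is half
    the probability that exactly one of two points at distance [|b - a|] lies in [Z];
    a boundary point then separates them, and counting such changes over disjoint
    intervals of (0, 1) bounds this probability by [r |b - a|].

    Conversely, admissibility makes finite the sublinear functional that the
    constraints induce on bounded functions of configurations; by Hahn-Banach it
    dominates a shift-invariant finitely additive mean with second moments [S2]. Its
    finite-dimensional laws on the rationals are realized on [Omega] by nested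
    intervals of the uniform variable, which yields a stationary field [X_q],
    [q] rational, and [Z] is the closure of [{q | X_q = 1}]. By the Lipschitz bound
    the expected number of changes of [X] along any grid of [a, b] is at most
    [r (b - a)]; with Fatou's lemma this bounds the number of boundary points
    of [Z] and shows that almost surely [q \in Z] if and only if [X_q = 1]. Hence
    the covariogram of [Z] is [S2] on the rationals, and everywhere by continuity. *)
Require Import Defs.
From HB Require Import structures.
From mathcomp Require Import all_boot all_order all_algebra.
From mathcomp Require Import all_classical all_reals all_analysis.
From mathcomp Require Import measurable_realfun.
From mathcomp Require Import ring lra.
Set Implicit Arguments. Unset Strict Implicit. Unset Printing Implicit Defensive.
Import Order.TTheory GRing.Theory Num.Theory.
Import numFieldNormedType.Exports.
Local Open Scope classical_set_scope.
Local Open Scope ring_scope.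

(** * Linear functionals below a sublinear one *)

Section sublinear.
Context {R : realType} {V : lmodType R} (D : set V).
Hypothesis DD : forall x y, D x -> D y -> D (x + y).
Hypothesis DZ : forall t x, D x -> D (t *: x).

(** One inequality for positive scalars suffices for homogeneity: applying it to [t^-1] gives the
    converse. *)
Definition sublinear_on (q : V -> R) :=
  (forall x y, D x -> D y -> q (x + y) <= q x + q y) /\
  (forall t x, D x -> 0 < t -> q (t *: x) <= t * q x).

Let DN x : D x -> D (- x).
Proof. by rewrite -scaleN1r; exact: DZ. Qed.

Lemma sublinear_onZ q t x : sublinear_on q -> D x -> 0 < t ->
  q (t *: x) = t * q x.
Proof.
move=> [_ qZ] Dx t0; apply/eqP; rewrite eq_le qZ//=.
have := qZ t^-1 _ (DZ t Dx); rewrite invr_gt0 => /(_ t0).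
rewrite scalerA mulVf ?gt_eqF// scale1r => h.
by rewrite -ler_pdivlMl.
Qed.

Lemma sublinear_on_ge0 q x : sublinear_on q -> D x -> 0 <= q x + q (- x).
Proof.
move=> qs Dx; have [qD _] := qs.
have q0 : q 0 = 0.
  have D0 : D 0 by rewrite -(scale0r x); exact: DZ.
  have /(_ ltac:(lra)) := @sublinear_onZ q 2 0 qs D0.
  by rewrite scaler0; lra.
by have := qD x (- x) Dx (DN Dx); rewrite subrr q0.
Qed.

(** Superadditivity makes [q] additive, and additivity on [t *: x] and [(- t) *: x] extends
    homogeneity to negative scalars. *)
Lemma sublinear_on_linear q :
  sublinear_on q -> (forall x y, D x -> D y -> q x + q y <= q (x + y)) ->
  (forall x y, D x -> D y -> q (x + y) = q x + q y) /\
  (forall t x, D x -> q (t *: x) = t * q x).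
Proof.
move=> qs qge; have [qD _] := qs.
have qadd x y : D x -> D y -> q (x + y) = q x + q y.
  by move=> Dx Dy; apply/eqP; rewrite eq_le qD// qge.
split=> // t x Dx.
have D0 : D 0 by rewrite -(scale0r x); exact: DZ.
have q0 : q 0 = 0.
  by have := qadd 0 0 D0 D0; rewrite addr0; lra.
have [t0|t0|<-] := ltgtP 0 t; last by rewrite scale0r mul0r.
  exact: sublinear_onZ.
have /(_ ltac:(lra)) := @sublinear_onZ q (- t) x qs Dx.
have := qadd (t *: x) ((- t) *: x) (DZ _ Dx) (DZ _ Dx).
by rewrite -scalerDl subrr scale0r q0; lra.
Qed.

Variable p : V -> R.
Hypothesis ps : sublinear_on p.

Let T := {q : V -> R | sublinear_on q /\ forall x, D x -> q x <= p x}.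
(** The order is reversed, so that the maximal element given by Zorn's lemma is a minimal
    functional. *)
Let Rel (q1 q2 : T) : bool := `[< forall x, D x -> sval q2 x <= sval q1 x >].

(** The bound is the pointwise infimum, finite because [- p (- x)] lies below every member at [x].
    For subadditivity, of two members nearly optimal at [x] and at [y], the smaller one is nearly
    optimal at both. *)
Let chain_inf (A : set T) : total_on A (fun x y => Rel x y) -> A !=set0 ->
  exists t, forall s, A s -> Rel s t.
Proof.
move=> Atot [q0 Aq0].
pose S x := [set sval q x | q in A].
have S0 x : S x !=set0 by exists (sval q0 x); exists q0.
have Slb x : D x -> lbound (S x) (- p (- x)).
  move=> Dx _ [q Aq <-].
  have := sublinear_on_ge0 (svalP q).1 Dx.
  by have := (svalP q).2 (- x) (DN Dx); lra.
have hS x : D x -> has_inf (S x).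
  by move=> Dx; split => //; exists (- p (- x)); exact: Slb.
pose qi x := inf (S x).
have qiq q x : D x -> A q -> qi x <= sval q x.
  by move=> Dx Aq; apply: ge_inf; [exact: (hS _ Dx).2 | exists q].
have qis : sublinear_on qi.
  split=> [x y Dx Dy|t x Dx t0].
    apply/ler_addgt0Pr => e e0.
    have e2 : 0 < e / 2 by lra.
    have [_ [q1 A1 <-] h1] := inf_adherent e2 (hS _ Dx).
    have [_ [q2 A2 <-] h2] := inf_adherent e2 (hS _ Dy).
    have [q Aq [l1 l2]] : exists2 q, A q & sval q x <= sval q1 x /\ sval q y <= sval q2 y.
      have [/asboolP H|/asboolP H] := Atot _ _ A1 A2.
        by exists q2 => //; split => //; exact: H.
      by exists q1 => //; split => //; exact: H.
    have := qiq q _ (DD Dx Dy) Aq.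
    have := (svalP q).1.1 x y Dx Dy.
    by rewrite -/(qi x) -/(qi y) in h1 h2 *; lra.
  rewrite -ler_pdivrMl//; apply: lb_le_inf => // _ [q Aq <-].
  rewrite ler_pdivrMl//; apply: (le_trans (qiq q _ (DZ t Dx) Aq)).
  exact: (svalP q).1.2.
have qip : forall x, D x -> qi x <= p x.
  by move=> x Dx; apply: le_trans (qiq _ _ Dx Aq0) _; exact: (svalP q0).2.
by exists (exist _ qi (conj qis qip)) => s As; apply/asboolP => x Dx; exact: qiq.
Qed.

(** A minimal sublinear functional [q] is linear: for [y] fixed,
    [x |-> inf_(t >= 0) (q (x + t y) - t q y)] is again sublinear and below [q]. *)
Lemma sublinear_on_dominates_linear : exists E : V -> R,
  [/\ forall x y, D x -> D y -> E (x + y) = E x + E y,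
      forall t x, D x -> E (t *: x) = t * E x &
      forall x, D x -> E x <= p x].
Proof.
have pT : sublinear_on p /\ forall x, D x -> p x <= p x by [].
have [||A Atot|[q [qs qp]] qmin] := @ZL_preorder T (exist _ p pT) Rel.
- by move=> t; apply/asboolP.
- move=> r s t /asboolP rs /asboolP st; apply/asboolP => x Dx.
  exact: le_trans (st _ Dx) (rs _ Dx).
- have [A0|/set0P A0] := eqVneq A set0; last exact: chain_inf.
  by exists (exist _ p pT) => s; rewrite A0.
have [E1 E2] : (forall x y, D x -> D y -> q (x + y) = q x + q y) /\
  (forall t x, D x -> q (t *: x) = t * q x).
  apply: sublinear_on_linear => // x y Dx Dy.
  pose S x := [set q (x + t *: y) - t * q y | t in [set t | 0 <= t]].
  have qt t : 0 <= t -> q (t *: y) = t * q y.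
    rewrite le_eqVlt => /predU1P[<-|]; last exact: sublinear_onZ.
    have D0 : D 0 by rewrite -(scale0r x); exact: DZ.
    have /(_ ltac:(lra)) := @sublinear_onZ q 2 0 qs D0.
    by rewrite scaler0 scale0r mul0r; lra.
  have hS z : D z -> has_inf (S z).
    move=> Dz; split; first by exists (q (z + 0 *: y) - 0 * q y); exists 0 => /=.
    exists (- q (- z)) => _ [t /= t0 <-].
    have := qs.1 (z + t *: y) (- z) (DD Dz (DZ _ Dy)) (DN Dz).
    by rewrite [z + _]addrC addrK qt//; lra.
  have lS z t : D z -> 0 <= t -> inf (S z) <= q (z + t *: y) - t * q y.
    by move=> Dz t0; apply: ge_inf; [exact: (hS _ Dz).2|exists t].
  have lq z : D z -> inf (S z) <= q z.
    by move=> Dz; have := lS z 0 Dz (lexx _); rewrite scale0r addr0 mul0r subr0.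
  have qys : sublinear_on (fun z => inf (S z)).
    split=> [u v Du Dv|s u Du s0].
      apply/ler_addgt0Pr => e e0.
      have e2 : 0 < e / 2 by lra.
      have [_ [t1 /= t10 <-] h1] := inf_adherent e2 (hS _ Du).
      have [_ [t2 /= t20 <-] h2] := inf_adherent e2 (hS _ Dv).
      have := lS (u + v) (t1 + t2) (DD Du Dv) (addr_ge0 t10 t20).
      have := qs.1 (u + t1 *: y) (v + t2 *: y) (DD Du (DZ _ Dy)) (DD Dv (DZ _ Dy)).
      by rewrite addrACA -scalerDl; lra.
    rewrite -ler_pdivrMl//; apply: lb_le_inf; first exact: (hS _ Du).1.
    move=> _ [t /= t0 <-]; rewrite ler_pdivrMl//.
    have := lS (s *: u) (s * t) (DZ _ Du) (mulr_ge0 (ltW s0) t0).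
    rewrite -scalerA -scalerDr (sublinear_onZ qs _ s0); last by apply: DD => //; exact: DZ.
    by lra.
  have qyp z : D z -> inf (S z) <= p z.
    by move=> Dz; exact: le_trans (lq _ Dz) (qp _ Dz).
  (* Minimality puts [q] below the new functional; the choice [t = 1] in the infimum at [x] then
     gives [q x <= q (x + y) - q y]. *)
  have := qmin (exist _ (fun z => inf (S z)) (conj qys qyp)).
  move=> /(_ ltac:(apply/asboolP; exact: lq))/asboolP/= /(_ _ Dx).
  by have := lS x 1 Dx ler01; rewrite scale1r mul1r; lra.
by exists q.
Qed.

End sublinear.

(** * Integrals of linear combinations and translation of Lebesgue measure *)

Section Rintegral_combination.
Context {d} {T : measurableType d} {R : realType}.
Variables (mu : {measure set T -> \bar R}) (D : set T).
Hypotheses (mD : measurable D) (muD : mu D = 1%E).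

(** The constant [c] is its own integral because [D] has mass one. Used for Lebesgue measure on ]0,
    1[ and for the probability [P]. *)
Lemma Rintegral_combination_ge0 (n : nat) (a : 'I_n -> R) (f : 'I_n -> T -> R)
    (c : R) :
  (forall i, mu.-integrable D (EFin \o f i)) ->
  (forall x, D x -> 0 <= c + \sum_(i < n) a i * f i x) ->
  0 <= c + \sum_(i < n) a i * \int[mu]_(x in D) f i x.
Proof.
move=> fi ge0.
have isum (s : seq 'I_n) :
    mu.-integrable D (EFin \o (fun x => \sum_(i <- s) a i * f i x)) /\
    \int[mu]_(x in D) (\sum_(i <- s) a i * f i x) =
    \sum_(i <- s) a i * \int[mu]_(x in D) f i x.
  have afi i : mu.-integrable D (EFin \o (fun x => a i * f i x)).
    by have := integrableZl mD (a i) (fi i).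
  elim: s => [|i s [ihi ihs]].
    split.
      have -> : EFin \o (fun x => \sum_(i <- [::]) a i * f i x) = cst 0%E.
        by apply/funext => x /=; rewrite big_nil.
      exact: integrable0.
    rewrite big_nil (@eq_Rintegral _ _ _ mu D (cst 0)); last first.
      by move=> x _; rewrite big_nil.
    by rewrite Rintegral_cst// mul0r.
  split.
    have -> : EFin \o (fun x => \sum_(j <- i :: s) a j * f j x) =
       (EFin \o (fun x => a i * f i x)) \+
       (EFin \o (fun x => \sum_(j <- s) a j * f j x)).
      by apply/funext => x /=; rewrite big_cons EFinD.
    exact: integrableD.
  rewrite big_cons -ihs -RintegralZl// -RintegralD//.
  by apply: eq_Rintegral => x _; rewrite big_cons.
have [si se] := isum (index_enum 'I_n).
have ci : mu.-integrable D (EFin \o cst c).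
  apply: measurable_bounded_integrable => //; first by rewrite muD ltry.
  exact: bounded_cst.
rewrite -se (_ : c = \int[mu]_(x in D) cst c x); last first.
  by rewrite Rintegral_cst// muD mulr1.
by rewrite -RintegralD//; exact: Rintegral_ge0.
Qed.

End Rintegral_combination.

Section lebesgue_translation.
Context {R : realType}.
Local Notation lambda := (@lebesgue_measure R).

Lemma measurable_addr (t : R) (A : set R) : measurable A ->
  measurable [set x | A (x + t)].
Proof.
move=> mA.
have m : measurable_fun [set: R] (fun x : R => x + t).
  by apply: measurable_funD => //; exact: measurable_cst.
by have := m measurableT A mA; rewrite setTI.
Qed.

(** The pushforward under translation agrees with Lebesgue measure on half-open intervals, which
    determine it. *)
Lemma lebesgue_measure_addr (t : R) (A : set R) : measurable A ->
  lambda [set x | A (x + t)] = lambda A.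
Proof.
move=> mA; apply/esym.
have m : @measurable_fun _ _ (measurableTypeR R) (measurableTypeR R) setT
    (fun x => x + t).
  by apply: (@measurable_funD _ _ R) => //; exact: measurable_cst.
apply: (@lebesgue_measure_unique _
  (measure_function_pushforward__canonical__measure_function_Measure lambda m)) => //.
move=> X [[a b] _ <-] /=.
rewrite /pushforward (_ : _ @^-1` _ = `]a - t, b - t]%classic); last first.
  apply/seteqP; split => x; rewrite /= !in_itv/=.
    by move=> /andP[? ?]; apply/andP; split; lra.
  by move=> /andP[? ?]; apply/andP; split; lra.
rewrite !lebesgue_measure_itv/= !lte_fin.
rewrite ltrD2r; case: ifP => // _.
by rewrite -!EFinB; congr EFin; ring.
Qed.

End lebesgue_translation.

(** * Shifts of configurations and covariograms over unit windows *)

Section shift.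
Context {R : realType}.
Implicit Types (F : set R) (t y : R).
Local Notation lambda := (@lebesgue_measure R).

Definition shift t F : set R := [set x | F (x + t)].

Lemma shiftD s t F : shift s (shift t F) = shift (s + t) F.
Proof. by apply/funext => x; rewrite /shift /= addrA. Qed.

Lemma shift0 F : shift 0 F = F.
Proof. by apply/funext => x; rewrite /shift /= addr0. Qed.

Lemma translateE y F x : translate y F x <-> F (x - y).
Proof.
split=> [[z Fz <-]|Fx]; first by rewrite addrAC subrr add0r.
by exists (x - y) => //; rewrite addrC subrK.
Qed.

Lemma translate_shift y F : translate y F = shift (- y) F.
Proof. by apply/seteqP; split => x /translateE. Qed.

Lemma measurable_translate y F : measurable F -> measurable (translate y F).
Proof. by move=> mF; rewrite translate_shift; exact: measurable_addr. Qed.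

(** The indicator of the origin lying in [F] and in its translate by [y]; its mean is what [S2 y]
    prescribes. *)
Definition pair_ind y F : R := (`[< F 0 /\ F (- y) >])%:R.

Definition pair_slice y t F : set R := [set u | (F `&` translate y F) (u + t)].

Lemma measurable_pair_slice y t F : closed F -> measurable (pair_slice y t F).
Proof.
move=> /closed_measurable mF; apply: measurable_addr.
by apply: measurableI => //; exact: measurable_translate.
Qed.

Lemma pair_ind_shift y t F :
  (fun u => pair_ind y (shift (u + t) F)) = \1_(pair_slice y t F).
Proof.
apply/funext => u; rewrite /pair_ind indicE.
suff -> : (u \in pair_slice y t F) =
  `[< shift (u + t) F 0 /\ shift (u + t) F (- y) >] by [].
have GE : pair_slice y t F u <-> shift (u + t) F 0 /\ shift (u + t) F (- y).
  by rewrite /pair_slice /shift/= translateE add0r [- y + _]addrC.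
by apply/idP/asboolP; rewrite inE => /GE.
Qed.

Lemma delta_itv y t F : closed F ->
  delta y `]t, t + 1[ F = \int[lambda]_(u in `]0, 1[) pair_ind y (shift (u + t) F).
Proof.
move=> cF; have mF := closed_measurable cF.
rewrite pair_ind_shift /Rintegral integral_indic//; last exact: measurable_pair_slice.
rewrite /delta; congr fine.
rewrite -(@lebesgue_measure_addr _ t); last first.
  by apply: measurableI => //; apply: measurableI => //; exact: measurable_translate.
congr (lambda _); apply/seteqP; split => u; rewrite /pair_slice /= !in_itv/= => -[? /andP[? ?]].
  by split=> //; apply/andP; split; lra.
by split=> //; apply/andP; split; lra.
Qed.

Lemma class_W_itv t : class_W (`]t, t + 1[%classic : set R).
Proof.
split; [|split].
- exists (`|t| + 1); split; first exact: num_real.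
  move=> M tM x /=; rewrite in_itv/= => /andP[tx xt].
  apply: le_trans (ltW tM); rewrite ler_norml; apply/andP.
  by have := ler_norm t; have := ler_norm (- t); rewrite normrN; split; lra.
- exact: itv_open.
- apply/eqP; rewrite eq_le measure_ge0 andbT.
  have -> : 0%E = (lambda [set t] + lambda [set (t + 1)%R])%E.
    by rewrite !lebesgue_measure_set1 adde0.
  apply: le_trans (measureU2 _ _ _) => //; apply: le_measure; rewrite ?inE.
  + apply: measurableD; first by apply: closed_measurable; exact: closed_closure.
    by apply: open_measurable; exact: open_interior.
  + by apply: measurableU.
  + move=> x [/itv_closure]; rewrite interior_itv /= !in_itv/= => /andP[tx xt] nx.
    have [/eqP ?|nxt] := boolP (x == t); first by left.
    right; apply/eqP; rewrite eq_le xt leNgt; apply: contra_notN nx => xt1.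
    by rewrite xt1 lt_neqAle eq_sym nxt tx.
Qed.

End shift.

(** * A shift-invariant mean with prescribed second moments *)

Section shift_average.
Context {R : realType}.
Implicit Types (s : seq R) (l : seq (R * R)) (f g : set R -> R).
Local Notation lambda := (@lebesgue_measure R).

Definition avg s f (F : set R) : R :=
  (size s)%:R^-1 * \sum_(t <- s) f (shift t F).

(** Apply admissibility to the windows [t, t + 1[ with t ranging over [s]: summing
    the covariograms of a closed set [F] over them amounts to integrating the
    average of [pair_ind] over the shifts of [F] by [u] in ]0, 1[. *)
Lemma admissible_avg_ge0 (S2 : R -> R) s l (B : R) :
  F_scov_admissible S2 -> s != [::] ->
  (forall F, 0 <= B + \sum_(a <- l) a.1 * (avg s (pair_ind a.2) F - S2 a.2)) ->
  0 <= B.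
Proof.
move=> adm s0 ge0.
(* Without constraints the hypothesis is already the claim; otherwise the family below is nonempty,
   as admissibility demands. *)
have [l0|l0] := eqVneq l [::]; first by have := ge0 set0; rewrite l0 big_nil addr0.
have ss : (size s)%:R != 0 :> R by rewrite pnatr_eq0 size_eq0.
have lambda01 : lambda `]0, 1[%classic = 1%E.
  by rewrite lebesgue_measure_itv/= lte_fin ltr01 -EFinB subr0.
(* The finite family consists of all pairs of a constraint and a window. The constant [c] is chosen
   so that the conclusion of admissibility reduces to [0 <= B]. *)
pose z := [seq (a, t) | a <- l, t <- s].
pose q := size z.
pose Z := tnth (in_tuple z).
pose c := B - \sum_(a <- l) a.1 * S2 a.2.
have q1 : (1 <= q)%N.
  by rewrite /q size_allpairs muln_gt0 !lt0n !size_eq0 l0.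
have sumE (h : (R * R) * R -> R) :
    \sum_(i < q) h (Z i) = \sum_(a <- l) \sum_(t <- s) h (a, t).
  by rewrite -(big_tnth _ _ _ xpredT h) /= big_allpairs.
have := adm q q1 (fun i => (Z i).1.1 / (size s)%:R) (fun i => (Z i).1.2)
  (fun i => `](Z i).2, (Z i).2 + 1[%classic) c.
rewrite (sumE (fun x => x.1.1 / (size s)%:R * S2 x.1.2 * fine (lambda `]x.2, x.2 + 1[%classic)))/=.
have -> : \sum_(a <- l) \sum_(t <- s)
   a.1 / (size s)%:R * S2 a.2 * fine (lambda `]t, t + 1[%classic) =
   \sum_(a <- l) a.1 * S2 a.2.
  apply: eq_bigr => a _; rewrite (eq_bigr (fun=> a.1 / (size s)%:R * S2 a.2)).
    by rewrite big_const_seq count_predT iter_addr_0 -mulr_natr; field.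
  move=> t _; rewrite lebesgue_measure_itv/= lte_fin ltrDl ltr01.
  by rewrite -EFinB/= [t + 1]addrC addrK mulr1.
rewrite /c subrK; apply; first by move=> i; exact: class_W_itv.
move=> F cF; under eq_bigr do rewrite delta_itv//.
apply: (@Rintegral_combination_ge0 _ (measurableTypeR R) _ lambda `]0, 1[%classic).
- exact: measurable_itv.
- exact: lambda01.
- move=> i; rewrite pair_ind_shift.
  apply: measurable_bounded_integrable.
  + exact: measurable_itv.
  + by apply: (@le_lt_trans _ _ 1%E); [rewrite -lambda01|exact: ltry].
  + by apply: measurable_funTS; apply/measurable_indicP; exact: measurable_pair_slice.
  + exists 1; split; first exact: num_real.
    move=> M M1 u _ /=; apply: le_trans (ltW M1); rewrite indicE.
    by case: (_ \in _); rewrite ?normr1// normr0.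
move=> u _.
rewrite (sumE (fun x => x.1.1 / (size s)%:R * pair_ind x.1.2 (shift (u + x.2) F)))/=.
suff -> : \sum_(a <- l) \sum_(t <- s) a.1 / (size s)%:R * pair_ind a.2 (shift (u + t) F)
   = \sum_(a <- l) a.1 * avg s (pair_ind a.2) (shift u F).
  have := ge0 (shift u F).
  rewrite (eq_bigr (fun a => a.1 * avg s (pair_ind a.2) (shift u F) - a.1 * S2 a.2)).
    by rewrite sumrB; lra.
  by move=> a _; rewrite mulrBr.
apply: eq_bigr => a _; rewrite /avg mulrA big_distrr/=; apply: eq_bigr => t _.
by rewrite shiftD addrC.
Qed.


Lemma avgD s f g F : avg s (fun F => f F + g F) F = avg s f F + avg s g F.
Proof. by rewrite /avg big_split/= mulrDr. Qed.

Lemma avgZ s k f F : avg s (fun F => k * f F) F = k * avg s f F.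
Proof. by rewrite /avg -big_distrr/= mulrCA. Qed.

Lemma avg_cst s k F : s != [::] -> avg s (fun=> k) F = k.
Proof.
rewrite -size_eq0 => s0; rewrite /avg big_const_seq count_predT iter_addr_0.
by rewrite -(mulr_natr k) mulrCA mulVf ?mulr1// pnatr_eq0.
Qed.

Lemma le_avg s f g F : (forall F, f F <= g F) -> avg s f F <= avg s g F.
Proof. by move=> fg; rewrite ler_wpM2l ?invr_ge0// ler_sum. Qed.

Lemma avg_sum s l (h : R * R -> set R -> R) F :
  avg s (fun F => \sum_(a <- l) h a F) F = \sum_(a <- l) avg s (h a) F.
Proof.
by rewrite /avg exchange_big/= big_distrr.
Qed.

(** The Minkowski sum with multiplicities: averaging over it amounts to averaging over [s] and over
    [s'], in either order. *)
Definition sumseq s s' := [seq t + t' | t <- s, t' <- s'].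

Lemma avg_sumseq s s' f F : avg (sumseq s s') f F = avg s' (avg s f) F.
Proof.
rewrite /avg /sumseq big_allpairs_dep size_allpairs natrM invfM [_^-1 * _]mulrC -mulrA.
congr (_ * _); rewrite -big_distrr/= exchange_big/=; congr (_ * _).
by apply: eq_bigr => t' _; apply: eq_bigr => t _; rewrite shiftD.
Qed.

Lemma avg_sumseqC s s' f F : avg (sumseq s s') f F = avg s (avg s' f) F.
Proof.
rewrite -avg_sumseq /avg; congr (_ * _); first by rewrite !size_allpairs mulnC.
rewrite /sumseq !big_allpairs_dep exchange_big/=.
by apply: eq_bigr => t' _; apply: eq_bigr => t _; rewrite addrC.
Qed.

End shift_average.

Section invariant_mean.
Context {R : realType} (S2 : R -> R).
Hypothesis adm : F_scov_admissible S2.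
Implicit Types (s : seq R) (l : seq (R * R)) (f g : set R -> R).

Definition bounded_cfg f := exists C, forall F, `|f F| <= C.

(** An averaged combination of the constraints; it has mean zero under every shift-invariant mean
    with second moments [S2]. *)
Let corr l s F := \sum_(a <- l) a.1 * (avg s (pair_ind a.2) F - S2 a.2).

Let corr_avg l s s' F : s' != [::] -> avg s' (corr l s) F = corr l (sumseq s s') F.
Proof.
move=> s'0; rewrite /corr avg_sum; apply: eq_bigr => a _.
by rewrite avgZ avgD avg_cst// avg_sumseq.
Qed.

Let corr_avgC l s s' F : s' != [::] -> avg s' (corr l s) F = corr l (sumseq s' s) F.
Proof.
move=> s'0; rewrite corr_avg//; apply: eq_bigr => a _.
by rewrite avg_sumseq avg_sumseqC.
Qed.

Let S f := [set B | exists s l, s != [::] /\ forall F, avg s f F <= B + corr l s F].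

(** The least upper bound of [f] obtainable by averaging over finitely many shifts
    and correcting by the constraints [E (pair_ind y) = S2 y]; a linear [E] below
    it is a shift-invariant mean that satisfies these constraints. *)
Let majorant f : R := inf (S f).

Let S_le f B : (forall F, f F <= B) -> S f B.
Proof.
move=> fB; exists [:: 0], [::]; split => // F.
by rewrite /avg big_seq1 invr1 mul1r /corr big_nil addr0.
Qed.

(** This is where admissibility enters: if [- C] bounds [f] from below, every [B] in [S f] makes
    [C + B] plus a correction nonnegative on all configurations, hence [0 <= C + B]. *)
Let hS f : bounded_cfg f -> has_inf (S f).
Proof.
move=> [C fC]; split.
  by exists C; apply: S_le => F; exact: le_trans (ler_norm _) (fC F).
exists (- C) => B [s [l [s0 h]]].
rewrite -subr_ge0 opprK; apply: (admissible_avg_ge0 adm s0 (l := l)) => F.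
have : - C <= avg s f F.
  rewrite -(avg_cst (- C) F s0); apply: le_avg => G.
  by have := fC G; rewrite ler_norml => /andP[].
by have := h F; rewrite /corr; lra.
Qed.

Let majorant_le f B : bounded_cfg f -> S f B -> majorant f <= B.
Proof. by move=> bf; exact: ge_inf (hS bf).2 _. Qed.

Let bounded_cfgD f g : bounded_cfg f -> bounded_cfg g ->
  bounded_cfg (fun F => f F + g F).
Proof.
move=> [C fC] [C' gC]; exists (C + C') => F.
by apply: le_trans (ler_normD _ _) _; exact: lerD.
Qed.

Let bounded_cfgZ k f : bounded_cfg f -> bounded_cfg (fun F => k * f F).
Proof. by move=> [C fC]; exists (`|k| * C) => F; rewrite normrM ler_wpM2l. Qed.

(** Nearly optimal data for [f] and [g] are merged by averaging both over [sumseq s s'] and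
    concatenating the two lists of constraints. *)
Let majorantD f g : bounded_cfg f -> bounded_cfg g ->
  majorant (fun F => f F + g F) <= majorant f + majorant g.
Proof.
move=> bf bg; apply/ler_addgt0Pr => e e0.
have e2 : 0 < e / 2 by lra.
have [B [s [l [s0 hB]]] h1] := inf_adherent e2 (hS bf).
have [B' [s' [l' [s'0 hB']]] h2] := inf_adherent e2 (hS bg).
suff : majorant (fun F => f F + g F) <= B + B' by rewrite /majorant; lra.
apply: majorant_le; first exact: bounded_cfgD.
exists (sumseq s s'), (l ++ l'); split.
  by rewrite -size_eq0 size_allpairs muln_eq0 !size_eq0 negb_or s0.
move=> F; rewrite avgD /corr big_cat/= addrACA; apply: lerD.
  rewrite avg_sumseq -/(corr _ _ _) -corr_avg// -{1}(avg_cst B F s'0) -avgD.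
  exact: le_avg.
rewrite avg_sumseqC -/(corr _ _ _) -corr_avgC// -{1}(avg_cst B' F s0) -avgD.
exact: le_avg.
Qed.

Let majorantZ k f : bounded_cfg f -> 0 < k ->
  majorant (fun F => k * f F) <= k * majorant f.
Proof.
move=> bf k0; rewrite -ler_pdivrMl//; apply: lb_le_inf; first exact: (hS bf).1.
move=> B [s [l [s0 h]]]; rewrite ler_pdivrMl//.
apply: majorant_le; first exact: bounded_cfgZ.
exists s, [seq (k * a.1, a.2) | a <- l]; split => // F.
rewrite avgZ /corr big_map/=.
rewrite (eq_bigr (fun a => k * (a.1 * (avg s (pair_ind a.2) F - S2 a.2)))); last first.
  by move=> a _; rewrite mulrA.
by rewrite -big_distrr -mulrDr/= ler_pM2l//; exact: h.
Qed.

Lemma invariant_mean : exists E : (set R -> R) -> R,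
  [/\ forall f g, bounded_cfg f -> bounded_cfg g ->
        E (fun F => f F + g F) = E f + E g,
      forall k f, bounded_cfg f -> E (fun F => k * f F) = k * E f,
      forall f B, bounded_cfg f -> (forall F, f F <= B) -> E f <= B,
      forall t f, bounded_cfg f -> E (fun F => f (shift t F)) = E f &
      forall y, E (pair_ind y) = S2 y].
Proof.
have [|||E [ED EZ Ep]] :=
    @sublinear_on_dominates_linear R (set R -> R^o) bounded_cfg _ _ majorant.
- exact: bounded_cfgD.
- exact: bounded_cfgZ.
- by split=> [f g|k f]; [exact: majorantD|move=> ? ?; exact: majorantZ].
have Ele f B : bounded_cfg f -> S f B -> E f <= B.
  by move=> bf Sf; exact: le_trans (Ep _ bf) (majorant_le bf Sf).
have Ege f B : bounded_cfg f -> S (fun F => - 1 * f F) B -> - B <= E f.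
  move=> bf Sf; have := Ele _ _ (bounded_cfgZ (-1) bf) Sf.
  by rewrite EZ// lerNl mulN1r.
exists E; split => //.
- by move=> f B bf fB; apply: Ele => //; exact: S_le.
- move=> t f bf.
  have bft : bounded_cfg (fun F => f (shift t F)).
    by have [C fC] := bf; exists C.
  have [C fC] := bf.
  have C0 : 0 <= C by apply: le_trans (fC set0).
  (* Averaged over the shifts by 0, [t], ..., [n t], the difference telescopes and is at most
     [2 C / (n + 1)] in absolute value. Both signs of [k] are needed to get an equality. *)
  have key k : `|k| = 1 -> forall e, 0 < e ->
      S (fun F => k * (f (shift t F) + - 1 * f F)) e.
    move=> k1 e e0.
    have [n ne] : exists n : nat, 2 * C / e <= n.+1%:R.
      exists (Num.trunc (2 * C / e)).
      by apply: ltW; exact: truncnS_gt.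
    exists [seq i%:R * t | i <- iota 0 n.+1], [::]; split => // F.
    rewrite /corr big_nil addr0 avgZ /avg size_map size_iota big_map.
    have -> : \sum_(j <- iota 0 n.+1)
        (f (shift t (shift (j%:R * t) F)) + -1 * f (shift (j%:R * t) F)) =
        f (shift (n.+1%:R * t) F) - f F.
      rewrite -[iota 0 n.+1]/(index_iota 0 n.+1).
      rewrite (eq_bigr (fun j => f (shift (j.+1%:R * t) F) - f (shift (j%:R * t) F))).
        rewrite (telescope_sumr (fun j => f (shift (j%:R * t) F)))//.
        by rewrite mul0r shift0.
      by move=> j _; rewrite shiftD -natr1 mulrDl mul1r mulN1r [t + _]addrC.
    apply: le_trans (ler_norm _) _; rewrite 2!normrM k1 mul1r ger0_norm ?invr_ge0//.
    rewrite ler_pdivrMl//; apply: le_trans (ler_normB _ _) _.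
    apply: (@le_trans _ _ (2 * C)).
      by have := fC F; have := fC (shift (n.+1%:R * t) F); lra.
    by rewrite -ler_pdivrMr.
  have bd : bounded_cfg (fun F => f (shift t F) + -1 * f F).
    by apply: bounded_cfgD => //; exact: bounded_cfgZ.
  have Ed : E (fun F => f (shift t F) + - 1 * f F) = E (fun F => f (shift t F)) - E f.
    rewrite (ED _ (fun F => - 1 * f F))//; last exact: bounded_cfgZ.
    by rewrite (EZ (-1)) // mulN1r.
  apply/eqP; rewrite -subr_eq0 -Ed eq_le; apply/andP; split.
    apply/ler_addgt0Pr => e e0; rewrite add0r.
    rewrite -[leLHS]mul1r -(EZ 1)//; apply: Ele; first exact: bounded_cfgZ.
    by apply: key => //; rewrite normr1.
  apply/ler_addgt0Pr => e e0; rewrite -lerBlDr sub0r.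
  by apply: Ege => //; apply: key => //; rewrite normrN1.
move=> y.
have by_ : bounded_cfg (pair_ind y).
  by exists 1 => F; rewrite /pair_ind; case: `[< _ >]; rewrite ?normr1 ?normr0.
(* The constraint at [y] with coefficient [k] is itself an admissible correction; [k = 1] and
   [k = -1] give the two inequalities. *)
have key (k : R) : S (fun F => k * pair_ind y F) (k * S2 y).
  exists [:: 0], [:: (k, y)]; split => // F.
  by rewrite /corr big_seq1 avgZ /= mulrBr addrC subrK.
apply/eqP; rewrite eq_le; apply/andP; split.
  rewrite -[leLHS]mul1r -(EZ 1)// -[leRHS]mul1r; apply: Ele; last exact: key.
  exact: bounded_cfgZ.
by have := Ege _ _ by_ (key (-1)); rewrite mulN1r opprK.
Qed.

End invariant_mean.

(** * Realizing finitely additive laws with a uniform variable *)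

(** A finitely additive probability [mu] on a space [T] is realized, on the
    algebra generated by countably many events [x n], by genuine random
    variables: each word [w] of outcomes receives a half-open interval of length
    [mu (cylinder w)], split in two by the next outcome, and the outcomes are
    read off from the nested intervals containing a uniform variable. *)
Section realization.
Context {R : realType} {T : Type} (mu : set T -> R).
Hypotheses (mu_ge0 : forall A, 0 <= mu A) (mu1 : mu setT = 1)
  (muU : forall A B, A `&` B = set0 -> mu (A `|` B) = mu A + mu B).
Variable x : nat -> T -> bool.

Let mu0 : mu set0 = 0.
Proof. by have := muU (set0I (@set0 T)); rewrite setU0; lra. Qed.

Definition cylinder (w : seq bool) : set T := [set c | mkseq (x^~ c) (size w) = w].

Let p w := mu (cylinder w).

Let p_ge0 w : 0 <= p w. Proof. exact: mu_ge0. Qed.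

Let p0 : p [::] = 1.
Proof. by rewrite /p -mu1; congr mu; apply/seteqP; split. Qed.

Lemma cylinder_rcons w b :
  cylinder (rcons w b) = cylinder w `&` [set c | x (size w) c = b].
Proof.
apply/seteqP; split=> c; rewrite /cylinder /= size_rcons mkseqS.
  by move/rcons_inj => -[].
by move=> [-> ->].
Qed.

Let p_split w : p w = p (rcons w false) + p (rcons w true).
Proof.
rewrite /p !cylinder_rcons -muU.
  rewrite -setIUr; congr mu; apply/esym/setIidl => c _ /=.
  by case: x; [right|left].
by apply/seteqP; split => // c [[_ /= ->] [_ /=]].
Qed.

(** The left endpoint of the interval of [w]. The fold carries the prefix read so far; an outcome
    [true] skips the part reserved for [false]. *)
Let left w := (foldl (fun s b =>
  (rcons s.1 b, s.2 + if b then p (rcons s.1 false) else 0)) ([::], 0) w).2.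

Let left_rcons w b :
  left (rcons w b) = left w + if b then p (rcons w false) else 0.
Proof.
rewrite /left -cats1 foldl_cat /=; congr (_ + _).
set f := (fun s : _ * _ => _).
suff -> : (foldl f ([::], 0) w).1 = w by [].
by elim/last_ind: w => // w b' ih; rewrite -cats1 foldl_cat /= ih cats1.
Qed.

Let left_ge0 w : 0 <= left w.
Proof.
elim/last_ind: w => // w b ih; rewrite left_rcons.
by case: b; rewrite ?addr0// addr_ge0.
Qed.

Let right_le1 w : left w + p w <= 1.
Proof.
elim/last_ind: w => [|w b]; first by rewrite p0 /left/= add0r.
apply: le_trans; rewrite left_rcons (p_split w).
by have := p_ge0 (rcons w true); have := p_ge0 (rcons w false); case: b; lra.
Qed.

(** For [u] in ]0, 1], the word of length [n] whose interval, open on the left and closed on the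
    right, contains [u]; each digit tells in which of the two parts [u] lies. *)
Fixpoint word (u : R) n : seq bool :=
  if n is n'.+1 then
    let w := word u n' in rcons w (left w + p (rcons w false) < u)
  else [::].

Definition digit n u := left (word u n) + p (rcons (word u n) false) < u.

Let wordE u n : word u n = mkseq (digit^~ u) n.
Proof. by elim: n => // n ih; rewrite mkseqS -ih. Qed.

Let size_word u n : size (word u n) = n.
Proof. by rewrite wordE size_mkseq. Qed.

Let word_rcons u w b : word u (size (rcons w b)) = rcons w b <->
  word u (size w) = w /\ (left w + p (rcons w false) < u) = b.
Proof.
rewrite size_rcons /=; split => [/rcons_inj[wE]|[-> ->]]//.
by rewrite wE => ->.
Qed.

Let word_itv u w : 0 < u <= 1 ->
  word u (size w) = w <-> left w < u <= left w + p w.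
Proof.
move=> u01; elim/last_ind: w => [|w b ih].
  by split => //= _; rewrite p0 add0r.
rewrite word_rcons left_rcons ih (p_split w).
have := p_ge0 (rcons w true); have := p_ge0 (rcons w false).
case: b => h1 h2; split.
- by move=> [/andP[? ?] ->]; apply/andP; split; lra.
- by move=> /andP[h3 h4]; split => //; apply/andP; split; lra.
- move=> [/andP[? ?] /negbT]; rewrite -leNgt => ?; apply/andP; split; lra.
- move=> /andP[? ?]; split; first by apply/andP; split; lra.
  by apply/negbTE; rewrite -leNgt; lra.
Qed.

Context {d} {Omega : measurableType d} (P : probability Omega R) (U : Omega -> R).
Hypotheses (mU : measurable_fun setT U)
  (PU : forall t : R, 0 <= t <= 1 -> P [set w | U w <= t] = t%:E).

Let mle t : measurable [set w | U w <= t].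
Proof.
have := mU measurableT (measurable_itv `]-oo, t]); rewrite setTI.
by congr measurable; apply/seteqP; split => w; rewrite /= in_itv.
Qed.

Let PUoc a b : 0 <= a -> a <= b -> b <= 1 ->
  P [set w | a < U w <= b] = (b - a)%:E.
Proof.
move=> a0 ab b1.
have -> : [set w | a < U w <= b] = [set w | U w <= b] `\` [set w | U w <= a].
  apply/seteqP; split => w /=; first by move=> /andP[h ->]; split=> //; apply/negP; rewrite -ltNge.
  by move=> [-> /negP]; rewrite -ltNge => ->.
rewrite measureD//=; last by apply: le_lt_trans (probability_le1 _ _) (ltry _).
rewrite setIidr; last by move=> w /= h; exact: le_trans h ab.
rewrite EFinB; congr (_ - _)%E; apply: PU.
  by rewrite b1 andbT (le_trans a0 ab).
by rewrite a0 (le_trans ab b1).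
Qed.

Let m_word w : measurable [set o | word (U o) (size w) = w].
Proof.
elim/last_ind: w => [|w b ih].
  by rewrite (_ : [set _ | _] = setT)//; apply/seteqP; split.
have -> : [set o | word (U o) (size (rcons w b)) = rcons w b] =
    [set o | word (U o) (size w) = w] `&`
    [set o | (left w + p (rcons w false) < U o) = b].
  by apply/seteqP; split => o /word_rcons.
apply: measurableI => //; case: b.
  have := measurableC (mle (left w + p (rcons w false))).
  by congr measurable; apply/seteqP; split => o /=; rewrite ltNge => /negP.
have := mle (left w + p (rcons w false)).
congr measurable; apply/seteqP; split => o /=; first by move=> h; apply/negbTE; rewrite -leNgt.
by move=> /negbT; rewrite -leNgt.
Qed.

Let P_word w : P [set o | word (U o) (size w) = w] = (p w)%:E.
Proof.
have m01 : measurable [set o | 0 < U o <= 1].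
  have := measurableD (mle 1) (mle 0); congr measurable.
  apply/seteqP; split => o /=; last by move=> /andP[h ->]; split=> //; apply/negP; rewrite -ltNge.
  by move=> [-> /negP]; rewrite -ltNge => ->.
have P01 : P (~` [set o | 0 < U o <= 1]) = 0%E.
  by rewrite probability_setC// PUoc// subr0 subee.
have lw := left_ge0 w; have rw := right_le1 w; have pw := p_ge0 w.
set W := [set o | word (U o) (size w) = w].
have mW : measurable W by exact: m_word.
(* Outside ]0, 1] the word does not locate [U], but [U] falls there with probability zero. *)
transitivity (P (W `&` [set o | 0 < U o <= 1])).
  set J := [set o | 0 < U o <= 1] in m01 P01 *.
  have -> : P W = (P (W `&` J) + P (W `&` ~` J))%E.
    rewrite -measureU//; first by rewrite -setIUr setUv setIT.
    - exact: measurableI.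
    - by apply: measurableI => //; exact: measurableC.
    - by rewrite setIACA setICr setI0.
  rewrite [X in (_ + X)%E](_ : _ = 0%E) ?adde0//.
  apply/eqP; rewrite eq_le measure_ge0 andbT -P01; apply: le_measure; rewrite ?inE.
  - by apply: measurableI => //; exact: measurableC.
  - exact: measurableC.
  - by move=> ? [].
rewrite (_ : _ `&` _ = [set o | left w < U o <= left w + p w]).
  by rewrite PUoc//; [congr EFin; ring|lra].
apply/seteqP; split => o /= => [[h1 h2]|h]; first exact/(word_itv _ h2).
have h2 : 0 < U o <= 1 by case/andP: h => ? ?; apply/andP; split; lra.
by split => //; exact/(word_itv _ h2).
Qed.

(** Induction on the number [k] of outcomes still to be read: both sides are additive over the two
    extensions of [w], and once all outcomes are fixed the claim is [P_word]. *)
Let fdd_from (A : pred (seq bool)) k w :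
  measurable [set o | A (word (U o) (size w + k)) /\ word (U o) (size w) = w] /\
  P [set o | A (word (U o) (size w + k)) /\ word (U o) (size w) = w] =
  (mu [set c | A (mkseq (x^~ c) (size w + k)) /\ cylinder w c])%:E.
Proof.
elim: k w => [|k ih] w.
  rewrite addn0; have [Aw|Aw] := boolP (A w).
    have WE : [set o | A (word (U o) (size w)) /\ word (U o) (size w) = w] =
        [set o | word (U o) (size w) = w].
      by apply/seteqP; split => o /= => [[]//|h]; rewrite h.
    have CE : [set c | A (mkseq (x^~ c) (size w)) /\ cylinder w c] = cylinder w.
      by apply/seteqP; split => o /= => [[]//|h]; split => //; rewrite h.
    by rewrite CE; split; rewrite WE.
  have WE : [set o | A (word (U o) (size w)) /\ word (U o) (size w) = w] = set0.
    by apply/seteqP; split => o //= -[Ao h]; move: Ao; rewrite h (negbTE Aw).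
  have CE : [set c | A (mkseq (x^~ c) (size w)) /\ cylinder w c] = set0.
    by apply/seteqP; split => o //= -[Ao h]; move: Ao; rewrite h (negbTE Aw).
  by rewrite CE mu0; split; rewrite WE// measure0.
have [mt Pt] := ih (rcons w true); have [mf Pf] := ih (rcons w false).
rewrite !size_rcons !addSnnS in mt Pt mf Pf.
pose Q (b : bool) := [set o | A (word (U o) (size w + k.+1)) /\
  word (U o) (size w).+1 = rcons w b].
have QU : [set o | A (word (U o) (size w + k.+1)) /\ word (U o) (size w) = w] =
    Q false `|` Q true.
  apply/seteqP; split => o /=.
    move=> [Ao wo]; case E : (digit (size w) (U o)); [right|left]; split => //=;
    by move: E; rewrite /digit wo => ->.
  by move=> [[Ao /rcons_inj[? _]]|[Ao /rcons_inj[? _]]].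
rewrite QU; split; first exact: measurableU.
have -> : P (Q false `|` Q true) = (P (Q false) + P (Q true))%E.
  apply: measureU => //; apply/seteqP; split => // o [[_ h] [_]].
  by rewrite h => /rcons_inj[].
have PQf : P (Q false) = _ := Pf; have PQt : P (Q true) = _ := Pt.
rewrite PQf PQt.
rewrite -EFinD -muU; last first.
  apply/seteqP; split => // c [[_]]; rewrite cylinder_rcons => -[_ /= h] [_].
  by rewrite cylinder_rcons => -[_ /=]; rewrite h.
congr EFin; congr mu; apply/seteqP; split => c /=; rewrite !cylinder_rcons.
  by move=> [[? []]|[? []]].
by move=> [Ac wc]; case E : (x (size w) c); [right|left].
Qed.

Lemma digit_fdd (A : pred (seq bool)) n :
  measurable [set o | A (mkseq (digit^~ (U o)) n)] /\
  P [set o | A (mkseq (digit^~ (U o)) n)] = (mu [set c | A (mkseq (x^~ c) n)])%:E.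
Proof.
have [] := fdd_from A n [::]; rewrite /= add0n.
rewrite (_ : [set o | A (word (U o) n) /\ _] = [set o | A (mkseq (digit^~ (U o)) n)]); last first.
  by apply/seteqP; split => o /=; rewrite wordE => // -[].
rewrite (_ : [set c | A (mkseq (x^~ c) n) /\ _] = [set c | A (mkseq (x^~ c) n)])//.
by apply/seteqP; split => c //= -[].
Qed.

End realization.

(** * Lower limits, counting and boundary points *)

Section limn_einf_bounds.
Context {R : realType}.
Implicit Types (u : (\bar R)^nat) (c : \bar R).

Lemma limn_einf_ge u c : (\forall m \near \oo, (c <= u m)%E) -> (c <= limn_einf u)%E.
Proof.
move=> [N _ Nu]; rewrite limn_einf_lim; apply: lime_ge; first exact: is_cvg_einfs.
exists N => // n /= Nn; apply: le_ereal_inf_tmp => _ [k /= nk <-].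
by apply: Nu; exact: leq_trans nk.
Qed.

Lemma limn_einf_le u c : (forall m, (u m <= c)%E) -> (limn_einf u <= c)%E.
Proof.
move=> uc; rewrite limn_einf_lim; apply: lime_le; first exact: is_cvg_einfs.
apply: nearW => n; apply: le_trans (uc n).
apply: ereal_inf_lbound; exists n => //=.
Qed.

End limn_einf_bounds.

Section integral_lemmas.
Context {d} {T : measurableType d} {R : realType}.

(** Used with [g] the number of boundary points, whose measurability is never shown. *)
Lemma le_integral_pointwise (mu : {measure set T -> \bar R}) (f g : T -> \bar R) :
  (forall x, 0 <= f x)%E -> (forall x, f x <= g x)%E ->
  (\int[mu]_x f x <= \int[mu]_x g x)%E.
Proof.
move=> f0 fg; have g0 x : (0 <= g x)%E by exact: le_trans (fg x).
rewrite !ge0_integralE// !patch_setT; apply: ereal_sup_le => _ [h /= hf <-].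
by exists h => // x; exact: le_trans (hf x) _.
Qed.

Lemma probability_symdiff (P : probability T R) (A B : set T) (a b : R) :
  measurable A -> measurable B -> P A = a%:E -> P B = a%:E ->
  P (A `&` B) = b%:E -> P ((A `\` B) `|` (B `\` A)) = (2 * (a - b))%:E.
Proof.
move=> mA mB PA PB PAB.
have fin S : measurable S -> (P S < +oo)%E.
  by move=> mS; exact: le_lt_trans (probability_le1 P mS) (ltry _).
have PD1 : P (A `\` B) = (a - b)%:E by rewrite measureD// ?EFinB -?PA -?PAB//; exact: fin.
have PD2 : P (B `\` A) = (a - b)%:E 
  by rewrite measureD// ?EFinB -?PB -?PAB ?[A `&` B]setIC//; exact: fin.
have -> : P ((A `\` B) `|` (B `\` A)) = (P (A `\` B) + P (B `\` A))%E.
  apply: measureU; try exact: measurableD.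
  by apply/seteqP; split => // x [[_ ?] []].
by rewrite PD1 PD2 -EFinD; congr EFin; ring.
Qed.

End integral_lemmas.

Lemma sum_indic_size {R : realType} {T : Type} (E : nat -> set T) (m : nat) (w : T) :
  (\sum_(k < m) (\1_(E k) w : R)%:E =
   ((size [seq k <- iota 0 m | `[< E k w >]])%:R : R)%:E)%E.
Proof.
rewrite sumEFin size_filter -sum1_count natr_sum/= [in RHS]big_mkcond/=.
rewrite -(big_mkord xpredT (fun k => \1_(E k) w)) /= /index_iota subn0.
congr EFin; apply: eq_bigr => k _; rewrite indicE.
by case: ifPn => [/asboolP Ek|/asboolPn Ek]; [rewrite mem_set|rewrite memNset].
Qed.

Section counting_lemmas.
Context {R : realType} {T : choiceType}.
Implicit Types (s : seq T) (A : set T).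

Lemma size_le_counting s A : uniq s -> (forall x, x \in s -> A x) ->
  (((size s)%:R : R)%:E <= counting A)%E.
Proof.
move=> us sA; rewrite /counting; case: ifPn => [/asboolP finA|_]; last exact: leey.
rewrite lee_fin ler_nat; apply: uniq_leq_size => // x /sA Ax.
by rewrite in_fset_set// inE.
Qed.

(** An infinite set has finite subsets of every size, which a finite [c] would contradict. *)
Lemma counting_le A (c : \bar R) :
  (forall s, uniq s -> (forall x, x \in s -> A x) -> ((size s)%:R%:E <= c)%E) ->
  (counting A <= c)%E.
Proof.
move=> H; rewrite /counting; case: ifPn => [/asboolP finA|/asboolPn infA].
  by apply: H; [exact: finmap.fset_uniq|move=> x; rewrite in_fset_set// inE].
have c0 : (0 <= c)%E by have := H [::] isT; apply.
case: c c0 H => [r r0 H|//|//].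
have [B BA nB] := infinite_set_fset (Num.trunc r).+1 infA.
have := H _ (finmap.fset_uniq B) (fun x xB => BA x xB).
rewrite lee_fin leNgt => /negP[].
by apply: lt_le_trans (truncnS_gt r) _; rewrite ler_nat.
Qed.

End counting_lemmas.

Section boundary_points.
Context {R : realType}.
Implicit Types (F : set R) (x y z : R).

Lemma boundaryE F : boundary F = closure F `&` closure (~` F).
Proof. by rewrite /boundary setDE -closure_setC. Qed.

Lemma boundaryC F : boundary (~` F) = boundary F.
Proof. by rewrite !boundaryE setCK setIC. Qed.

(** The supremum of the points of [F] in [x, y] is adherent to [F]; it is adherent to the complement
    because it is [y] or all points of [x, y] to its right miss [F]. *)
Lemma boundary_between F x y : x <= y -> F x -> ~ F y ->
  exists2 z, x <= z <= y & boundary F z.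
Proof.
move=> xy Fx nFy.
pose A := [set t | x <= t <= y /\ F t].
have Ax : A x by split => //; rewrite lexx.
have supA : has_sup A by split; [exists x|exists y => t [/andP[]]].
have xz : x <= sup A by exact: ub_le_sup supA.2 _ Ax.
have zy : sup A <= y by apply: ge_sup => [|t [/andP[]]//]; exists x.
exists (sup A); first by rewrite xz.
rewrite boundaryE; split => B /nbhs_ballP[e /= e0 eB].
  have [t At tz] := sup_adherent e0 supA.
  exists t; split; first exact: At.2.
  apply: eB; rewrite /ball/= ger0_norm ?subr_ge0; last exact: ub_le_sup supA.2 _ At.
  by lra.
have [zy_|zney] := eqVneq (sup A) y.
  by exists y; split => //; apply: eB; rewrite zy_; exact: ballxx.
have zlty : sup A < y by rewrite lt_neqAle zney.
pose t := Num.min y (sup A + e / 2).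
have tz : sup A < t by rewrite lt_min zlty/=; lra.
exists t; split.
  move=> Ft; have : t <= sup A.
    apply: ub_le_sup supA.2 _ _; split => //.
    by rewrite ge_min lexx andbT; apply/ltW; exact: le_lt_trans tz.
  by rewrite leNgt tz.
apply: eB; rewrite /ball/= ltr0_norm ?subr_lt0// opprB.
have : t <= sup A + e / 2 by rewrite ge_min lexx orbT.
by lra.
Qed.

Lemma boundary_between_neq F x y : x <= y -> F x <> F y ->
  exists2 z, x <= z <= y & boundary F z.
Proof.
move=> xy; have [Fx|Fx] := pselect (F x); have [Fy|Fy] := pselect (F y).
- by case; apply/propext.
- by move=> _; exact: boundary_between.
- by move=> _; rewrite -boundaryC; apply: boundary_between.
- by case; apply/propext.
Qed.

End boundary_points.

(** * Covariograms of stationary random closed sets *)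

Section stationary_racs.
Context {d} {Omega : measurableType d} {R : realType}.
Variables (P : probability Omega R) (Z : Omega -> set R).
Hypothesis racsZ : RACS Z.
Local Notation lambda := (@lebesgue_measure R).

Let closedZ w : closed (Z w). Proof. exact: racsZ.1. Qed.

Lemma RACS_measurable_point (x : R) : measurable [set w | Z w x].
Proof.
have := racsZ.2 [set x] (@compact_set1 _ x); congr measurable.
by apply/seteqP; split => w /=; [move=> [x' [Zx <-]]|move=> Zx; exists x].
Qed.

(** A point off the closed set [Z w] lies in a rational interval missed by [Z w], so the complement
    of the graph is a countable union of measurable rectangles. Tonelli's theorem needs this joint
    measurability. *)
Lemma RACS_measurable_graph (y : R) :
  measurable [set p : Omega * measurableTypeR R | Z p.1 (p.2 - y)].
Proof.
rewrite -[X in measurable X]setCK; apply: measurableC.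
have -> : ~` [set p : Omega * measurableTypeR R | Z p.1 (p.2 - y)] =
    \bigcup_(q in [set: rat * rat])
      ([set w | ~ (Z w `&` `[ratr q.1, ratr q.2] !=set0)] `*`
       (`]ratr q.1 + y, ratr q.2 + y[%classic : set (measurableTypeR R))).
  apply/seteqP; split => -[w u] /=.
    move=> nZ; have : open (~` Z w) by exact: closed_openC.
    rewrite openE => /(_ _ nZ)[e /= e0 eZ].
    have [q1] : exists q, ratr q \in `]u - y - e, u - y[.
      by apply: rat_in_itvoo; lra.
    rewrite in_itv/= => /andP[q11 q12].
    have [q2] : exists q, ratr q \in `]u - y, u - y + e[.
      by apply: rat_in_itvoo; lra.
    rewrite in_itv/= => /andP[q21 q22].
    exists (q1, q2) => //; split => /=; last by rewrite in_itv/=; apply/andP; split; lra.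
    move=> [v [Zv]]; rewrite /= in_itv/= => /andP[v1 v2].
    by apply: (eZ v) => //; rewrite /ball/= ltr_distlC; apply/andP; split; lra.
  move=> [[q1 q2] _ [/= nZ]]; rewrite in_itv/= => /andP[u1 u2] Zu; apply: nZ.
  by exists (u - y); split => //=; rewrite in_itv/=; apply/andP; split; lra.
apply: countable_bigcupT_measurable => [|q]; first exact: countableP.
apply: measurableX; last exact: measurable_itv.
apply: measurableC; apply: racsZ.2; exact: segment_compact.
Qed.

Hypothesis statZ : stationary P Z.

Definition pair_event (x y : R) := [set w | Z w x /\ Z w y].

Lemma measurable_pair_event x y : measurable (pair_event x y).
Proof. by apply: measurableI; exact: RACS_measurable_point. Qed.

Lemma stationary_pair (x y : R) : P (pair_event x y) = P (pair_event 0 (y - x)).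
Proof.
pose B := [set F : set R | F 0 /\ F (y - x)].
have hit1 (t : R) : fell_measurable [set F : set R | F t].
  apply: sub_sigma_algebra; exists [set t]; first exact: compact_set1.
  by apply/seteqP; split => F /=; [move=> [t' [Ft <-]]|move=> Ft; exists t].
have mB : fell_measurable B.
  pose X := g_sigma_algebraType (@fell_gen R).
  exact: (@measurableI _ X _ _ (hit1 0) (hit1 (y - x))).
have := statZ (- x) mB; rewrite /B /= => ->; congr (P _).
apply/seteqP; split => w [h1 h2]; split.
- by apply/translateE; rewrite sub0r opprK.
- by apply/translateE; rewrite opprK subrK.
- by move/translateE : h1; rewrite sub0r opprK.
- by move/translateE : h2; rewrite opprK subrK.
Qed.

(** The section at [w] is the set measured by the covariogram; subtracting 0 makes the first factor
    an instance of the measurable graph. *)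
Let cov_graph (y : R) (W : set R) : set (Omega * measurableTypeR R) :=
  [set p | Z p.1 (p.2 - 0)] `&` [set p | Z p.1 (p.2 - y)] `&` (setT `*` W).

Let measurable_cov_graph y W : measurable W -> measurable (cov_graph y W).
Proof.
move=> mW; apply: measurableI; last by apply: measurableX => //; exact: mW.
by apply: measurableI; exact: RACS_measurable_graph.
Qed.

Let xsection_cov_graph y W w :
  xsection (cov_graph y W) w = Z w `&` translate y (Z w) `&` W.
Proof.
apply/seteqP; split => u; rewrite /xsection /= inE.
  move=> [[/= Zu Zy] [_ /= Wu]]; split => //; split; last exact/translateE.
  by move: Zu; rewrite subr0.
move=> [[Zu /translateE Zy] Wu].
by split => //; split => //=; rewrite subr0.
Qed.

(** By Tonelli, integrate over [u] in [W] the probability that [u] and [u - y] lie in [Z], which by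
    stationarity is the same for all [u]. *)
Lemma integral_cov_window (y : R) (W : set R) : measurable W ->
  (\int[P]_w lambda (Z w `&` translate y (Z w) `&` W) =
   P (pair_event 0 (- y)) * lambda W)%E.
Proof.
move=> mW.
pose G := cov_graph y W.
have mG : measurable G by exact: measurable_cov_graph.
have := @indic_fubini_tonelli _ _ Omega (measurableTypeR R) R P lambda G mG.
rewrite indic_fubini_tonelli_FE// indic_fubini_tonelli_GE// => FT.
rewrite (eq_integral (fun w => (lambda \o xsection G) w)); last first.
  by move=> w _ /=; rewrite xsection_cov_graph.
rewrite FT.
have -> : (\int[lambda]_u (P \o ysection G) u =
   \int[lambda]_(u in W) P (pair_event 0 (- y)))%E.
  rewrite [RHS]integral_mkcond; apply: eq_integral => u _ /=.
  rewrite patchE; case: ifPn => [|nW].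
    rewrite inE => Wu; transitivity (P (pair_event u (u - y))).
      congr (P _); apply/seteqP; split => w.
        by rewrite /ysection /= inE => -[[/= + ?] _]; rewrite subr0.
      by move=> [? ?]; rewrite /ysection /= inE; split => //; split => //=; rewrite subr0.
    by rewrite stationary_pair addrAC subrr add0r.
  rewrite (_ : ysection G u = set0) ?measure0//.
  apply/seteqP; split => // w; rewrite /ysection /= inE => -[_ [_ /= Wu]].
  by move: nW; rewrite notin_setE.
by rewrite integral_cst.
Qed.

Context (S2 : R -> R).
Hypothesis covZ : forall y : R, specific_covariogram P Z y = (S2 y)%:E.

Lemma covariogram_pair (x y : R) : P (pair_event x y) = (S2 (x - y))%:E.
Proof.
rewrite -covZ /specific_covariogram integral_cov_window//.
by rewrite lebesgue_measure_itv/= lte_fin ltr01 -EFinB subr0 mule1 stationary_pair opprB.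
Qed.

(** The premise holds at [F = Z w] for each [w]; its expectation is the conclusion. *)
Lemma covariogram_admissible : F_scov_admissible S2.
Proof.
move=> q q1 a y W c WW ge0.
have mW i : measurable (W i) by apply: open_measurable; exact: (WW i).2.1.
have finW i : (lambda (W i) < +oo)%E.
  have [M [_ WM]] := (WW i).1.
  have sub : W i `<=` `[- (M + 1), M + 1].
    by move=> x Wx /=; rewrite in_itv/= -ler_norml; apply: WM => //; lra.
  apply: (@le_lt_trans _ _ (lambda `[(- (M + 1))%R, (M + 1)%R])).
    by apply: le_measure; rewrite ?inE; [exact: mW|exact: measurable_itv|exact: sub].
  by rewrite lebesgue_measure_itv/=; case: ifPn => _; rewrite -?EFinB ltry.
have mZ w : measurable (Z w) by exact: closed_measurable.
have fin i w : lambda (Z w `&` translate (y i) (Z w) `&` W i) \is a fin_num.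
  rewrite ge0_fin_numE//; apply: le_lt_trans (finW i).
  apply: le_measure; rewrite ?inE.
  - apply: measurableI; last exact: mW.
    by apply: measurableI; [exact: mZ|apply: measurable_translate; exact: mZ].
  - exact: mW.
  - exact: subIsetr.
have deltaE i w : (delta (y i) (W i) (Z w))%:E =
    lambda (Z w `&` translate (y i) (Z w) `&` W i) by rewrite fineK.
have intdelta i : (\int[P]_w (delta (y i) (W i) (Z w))%:E = (S2 (y i))%:E * lambda (W i))%E.
  under eq_integral do rewrite deltaE.
  by rewrite integral_cov_window// covariogram_pair sub0r opprK.
have intble i : P.-integrable setT (EFin \o (fun w => delta (y i) (W i) (Z w))).
  apply/integrableP; split.
    rewrite (_ : _ \o _ = fun w => lambda (Z w `&` translate (y i) (Z w) `&` W i)); last first.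
      by apply/funext => w /=; exact: deltaE.
    have := measurable_fun_xsection lambda (measurable_cov_graph (y i) (mW i)).
    by congr measurable_fun; apply/funext => w /=; rewrite xsection_cov_graph.
  rewrite (eq_integral (fun w => (delta (y i) (W i) (Z w))%:E)); last first.
    by move=> w _ /=; rewrite ger0_norm// fine_ge0.
  rewrite intdelta; apply: lte_mul_pinfty => //.
  by rewrite -[y i]opprK -sub0r -covariogram_pair.
have := @Rintegral_combination_ge0 _ _ _ P setT measurableT (probability_setT P) q a
  (fun i w => delta (y i) (W i) (Z w)) c intble (fun w _ => ge0 (Z w) (@closedZ w)).
congr (0 <= c + _); apply: eq_bigr => i _.
rewrite /Rintegral intdelta fineM ?mulrA//.
by rewrite ge0_fin_numE.
Qed.

(** If [Z] contains 0 and [- u] but not both 0 and [- v], it contains [- u] and misses [- v], which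
    has probability [S2 0 - S2 (v - u)]. The absolute value follows since [S2] is even. *)
Lemma covariogram_variation (a b : R) : `|S2 a - S2 b| <= S2 0 - S2 (b - a).
Proof.
have main u v : S2 u - S2 v <= S2 0 - S2 (v - u).
  have sub : pair_event 0 (- u) `<=`
      pair_event 0 (- v) `|` (pair_event (- u) (- u) `\` pair_event (- u) (- v)).
    move=> w [Z0 Zu]; have [Zv|nZv] := pselect (Z w (- v)); first by left.
    by right; split => // -[].
  have m1 := measurable_pair_event.
  have m2 : measurable (pair_event (- u) (- u) `\` pair_event (- u) (- v)).
    exact: measurableD.
  have h : (P (pair_event 0 (- u)) <= P (pair_event 0 (- v)) +
      P (pair_event (- u) (- u) `\` pair_event (- u) (- v)))%E.
    apply: le_trans (measureU2 P (m1 0 (- v)) m2).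
    by apply: le_measure; rewrite ?inE//; exact: measurableU.
  have PD : P (pair_event (- u) (- u) `\` pair_event (- u) (- v)) = (S2 0 - S2 (v - u))%:E.
    have -> : P (pair_event (- u) (- u) `\` pair_event (- u) (- v)) =
        (P (pair_event (- u) (- u)) - P (pair_event (- u) (- v)))%E.
      rewrite measureD//; last exact: le_lt_trans (probability_le1 P (m1 _ _)) (ltry _).
      by rewrite setIidr// => w [].
    by rewrite !covariogram_pair subrr opprK [- u + v]addrC.
  by move: h; rewrite PD !covariogram_pair !sub0r !opprK -EFinD lee_fin; lra.
have sym u : S2 (- u) = S2 u.
  have := covariogram_pair 0 u; have := covariogram_pair u 0.
  rewrite sub0r subr0 => h1 h2; apply: EFin_inj; rewrite -h1 -h2; congr (P _).
  by apply/seteqP; split => w [].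
rewrite ler_norml; apply/andP; split; last exact: main.
by have := main b a; rewrite -[in X in _ <= X -> _](sym (a - b)) opprB; lra.
Qed.

Lemma covariogram_change (x y : R) :
  measurable [set w | Z w x <> Z w y] /\
  P [set w | Z w x <> Z w y] = (2 * (S2 0 - S2 (x - y)))%:E.
Proof.
have mp := RACS_measurable_point.
have -> : [set w | Z w x <> Z w y] =
  ([set w | Z w x] `\` [set w | Z w y]) `|` ([set w | Z w y] `\` [set w | Z w x]).
  apply/seteqP; split => w /=; last by move=> [|] [h1 h2] h; apply: h2; rewrite ?h// -h.
  have [Zx|Zx] := pselect (Z w x); have [Zy|Zy] := pselect (Z w y).
  - by case; apply/propext.
  - by left.
  - by right.
  - by case; apply/propext.
split; first by apply: measurableU; exact: measurableD.
have P1 t : P [set w | Z w t] = (S2 0)%:E.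
  rewrite -(subrr t) -covariogram_pair; congr (P _).
  by apply/seteqP; split => w // [].
by apply: probability_symdiff; rewrite ?P1// -covariogram_pair.
Qed.

Context (r : R).
Hypothesis r0 : 0 < r.
Hypothesis bdZ : (\int[P]_w counting (boundary (Z w) `&` `]0%R, 1%R[) <= r%:E)%E.

(** Intervals of length [h] are placed in [m] cells of (0, 1). Each change across an interval
    produces a boundary point in its own cell, so the expected number of changes is at most [r]. *)
Lemma covariogram_change_count (h : R) (m : nat) : 0 < h -> m%:R * h < 1 ->
  m%:R * (2 * (S2 0 - S2 (- h))) <= r.
Proof.
move=> h0 mh; case: m mh => [|n]; first by rewrite !mul0r ltW.
set m := n.+1 => mh.
have m0 : 0 < m%:R :> R by rewrite ltr0n.
(* The interval is centred in the cell from [k / m] to [(k + 1) / m], strictly inside it since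
   [h < 1 / m]. *)
pose x (k : nat) := k%:R / m%:R + (m%:R^-1 - h) / 2.
have hm : h < m%:R^-1 by rewrite -[_^-1]mul1r ltr_pdivlMr// mulrC.
pose E k := [set w | Z w (x k) <> Z w (x k + h)].
have [mE PE] : (forall k, measurable (E k)) /\
    forall k, P (E k) = (2 * (S2 0 - S2 (- h)))%:E.
  split=> k; have [mk Pk] := covariogram_change (x k) (x k + h) => //.
  by rewrite Pk opprD addNKr.
have : (\int[P]_w \sum_(k < m) (\1_(E k) w : R)%:E <= r%:E)%E.
  apply: le_trans bdZ; apply: le_integral_pointwise => w.
    by apply: sume_ge0 => k _; rewrite lee_fin.
  pose good := [seq k <- iota 0 m | `[< E k w >]].
  have cho k : exists z, E k w -> x k <= z <= x k + h /\ boundary (Z w) z.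
    have [Ek|nEk] := pselect (E k w); last by exists 0.
    have [|z zE bz] := boundary_between_neq _ Ek; first by lra.
    by exists z.
  pose z k := sval (cid (cho k)).
  have zP k : E k w -> x k <= z k <= x k + h /\ boundary (Z w) (z k).
    by rewrite /z; case: cid.
  have zitv k : k \in good -> k%:R / m%:R < z k < k.+1%:R / m%:R.
    rewrite mem_filter => /andP[/asboolP/zP[/andP[z1 z2] _] _].
    rewrite /x in z1 z2; rewrite -natr1 mulrDl mul1r; apply/andP; split; lra.
  rewrite sum_indic_size -(size_map z).
  apply: size_le_counting.
    rewrite map_inj_in_uniq ?filter_uniq ?iota_uniq// => k l gk gl zkl.
    have /andP[k1 k2] := zitv k gk; have /andP[l1 l2] := zitv l gl.
    have kl : k%:R / m%:R < l.+1%:R / m%:R :> R by rewrite (lt_trans k1)// zkl.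
    have lk : l%:R / m%:R < k.+1%:R / m%:R :> R by rewrite (lt_trans l1)// -zkl.
    rewrite !ltr_pM2r ?invr_gt0// !ltr_nat !ltnS in kl lk.
    by apply/eqP; rewrite eqn_leq kl lk.
  move=> _ /mapP[k gk ->]; have /andP[k1 k2] := zitv k gk; split.
    by move: gk; rewrite mem_filter => /andP[/asboolP/zP[]].
  move: gk; rewrite mem_filter mem_iota add0n => /andP[_ /andP[_ km]].
  rewrite /= in_itv/=; apply/andP; split.
    by apply: le_lt_trans k1; rewrite divr_ge0.
  by apply: (lt_le_trans k2); rewrite ler_pdivrMr// mul1r ler_nat.
rewrite ge0_integral_sum//; last first.
  by move=> k; apply/measurable_EFinP; exact/measurable_indicP.
rewrite (eq_bigr (fun=> (2 * (S2 0 - S2 (- h)))%:E)); last first.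
  by move=> k _; rewrite integral_indic// setIT; exact: PE.
by rewrite sumEFin lee_fin big_const_ord iter_addr_0 -[_ *+ m]mulr_natl.
Qed.

Lemma covariogram_lipschitz : lipschitz_with (r / 2) S2.
Proof.
have D_ge0 h : 0 <= S2 0 - S2 h.
  by have := covariogram_variation 0 h; rewrite subr0; apply: le_trans.
(* [S2 0 - S2] is subadditive along multiples, by the variation bound. *)
have Dn h n : S2 0 - S2 (n%:R * h) <= n%:R * (S2 0 - S2 h).
  elim: n => [|n ih]; first by rewrite !mul0r subrr.
  have := covariogram_variation (n%:R * h) (n.+1%:R * h).
  rewrite -mulrBl -natr1 addrAC subrr add0r mul1r mulrDl mul1r => h1.
  have := le_trans (ler_norm _) h1.
  by rewrite mulrDl mul1r; lra.
(* Cut [h] into [n] steps shorter than [1 / m], each costing at most [r / m]. As [n <= m h + 1], the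
   total is at most [r h + r / m], and [m] is chosen with [r / m <= e]. *)
have main h : 0 < h -> 2 * (S2 0 - S2 (- h)) <= r * h.
  move=> h0; apply/ler_addgt0Pr => e e0.
  pose m := (Num.trunc (r / e)).+1.
  pose n := (Num.trunc (m%:R * h)).+1.
  have m0 : 0 < m%:R :> R by rewrite ltr0n.
  have n0 : 0 < n%:R :> R by rewrite ltr0n.
  have mn : m%:R * h < n%:R by exact: truncnS_gt.
  have nm : n%:R <= m%:R * h + 1.
    rewrite /n -natr1 lerD2r; have := truncn_itv (mulr_ge0 (ltW m0) (ltW h0)).
    by move=> /andP[].
  have re : r / m%:R <= e.
    by rewrite ler_pdivrMr// mulrC -ler_pdivrMr// ltW// truncnS_gt.
  have mh : m%:R * (h / n%:R) < 1 by rewrite mulrA ltr_pdivrMr// mul1r.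
  have h1 := covariogram_change_count (divr_gt0 h0 n0) mh.
  have := Dn (- (h / n%:R)) n; rewrite mulrN mulrCA divff ?gt_eqF// mulr1 => h2.
  rewrite -ler_pdivlMl// in h1.
  have h3 : 2 * (S2 0 - S2 (- h)) <= n%:R * (m%:R^-1 * r).
    apply: (@le_trans _ _ (n%:R * (2 * (S2 0 - S2 (- (h / n%:R)))))).
      by move: h2; lra.
    by rewrite ler_pM2l.
  apply: (le_trans h3); apply: (@le_trans _ _ ((m%:R * h + 1) * (m%:R^-1 * r))).
    by rewrite ler_wpM2r// mulr_ge0 ?invr_ge0// ltW.
  rewrite mulrDl mul1r lerD//; last by rewrite mulrC.
  by rewrite (mulrC m%:R) mulrA mulfK ?gt_eqF// mulrC.
move=> x y; have [->|xy] := eqVneq x y; first by rewrite !subrr !normr0 mulr0.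
wlog lt : x y xy / x < y.
  move=> H; have [|yx|/eqP] := ltgtP x y; first exact: H; last by rewrite (negbTE xy).
  by rewrite distrC [`|x - y|]distrC; apply: H; rewrite // eq_sym.
have := covariogram_variation y x; rewrite distrC => h1.
have := main (y - x); rewrite subr_gt0 opprB => /(_ lt) h2.
by rewrite [`|x - y|]distrC (gtr0_norm (_ : 0 < y - x)) ?subr_gt0//; lra.
Qed.

End stationary_racs.

(** * Construction of the random closed set *)

Section rational_field.
Context {d} {Omega : measurableType d} {R : realType}.
Variable P : probability Omega R.

(** The field stands for the indicator of the future [Z] on the rationals; predicates on tuples of
    values encode its finite-dimensional laws. *)
Definition rational_field (S2 : R -> R) (X : rat -> Omega -> bool) :=
  [/\ forall (s : seq rat) (A : pred (seq bool)),
        measurable [set o | A [seq X q o | q <- s]],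
      forall (t : rat) (s : seq rat) (A : pred (seq bool)),
        P [set o | A [seq X (q + t) o | q <- s]] =
        P [set o | A [seq X q o | q <- s]] &
      forall y : rat, P [set o | X 0 o && X (- y) o] = (S2 (ratr y))%:E].

Lemma rational_field_exists (S2 : R -> R) :
  carries_uniform P -> F_scov_admissible S2 ->
  exists X, rational_field S2 X.
Proof.
move=> [U [mU PU]] adm; have [E [ED EZ Ele Eshift Epair]] := invariant_mean adm.
pose ind (A : set (set R)) F : R := (`[< A F >])%:R.
have bind A : bounded_cfg (ind A).
  by exists 1 => F; rewrite /ind; case: `[< _ >]; rewrite ?normr1 ?normr0.
(* The mean restricted to indicators is a finitely additive probability on configurations, as the
   realization requires. *)
pose mu A := E (ind A).
have mu_ge0 A : 0 <= mu A.
  have bN : bounded_cfg (fun F => -1 * ind A F).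
    by exists 1 => F; rewrite mulN1r normrN /ind; case: `[< _ >]; rewrite ?normr1 ?normr0.
  have := Ele (fun F => -1 * ind A F) 0 bN; rewrite EZ// mulN1r oppr_le0; apply => F.
  by rewrite mulN1r oppr_le0 /ind.
have mu1 : mu setT = 1.
  apply/eqP; rewrite eq_le; apply/andP; split.
    by apply: Ele => // F; rewrite /ind; case: `[< _ >].
  have bN : bounded_cfg (fun F => -1 * ind setT F).
    by exists 1 => F; rewrite mulN1r normrN /ind; case: `[< _ >]; rewrite ?normr1 ?normr0.
  have := Ele (fun F => -1 * ind setT F) (-1) bN; rewrite EZ// mulN1r lerN2; apply => F.
  by rewrite mulN1r /ind asboolT.
have muU A B : A `&` B = set0 -> mu (A `|` B) = mu A + mu B.
  move=> AB; rewrite /mu -ED//; congr E; apply/funext => F.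
  rewrite /ind; have nAB : ~ (A F /\ B F) by move=> H; have : (A `&` B) F by []; rewrite AB.
  have [AF|AF] := pselect (A F); have [BF|BF] := pselect (B F).
  - by exfalso; apply: nAB.
  - by rewrite (asboolT AF) (asboolF BF) asboolT ?addr0//; left.
  - by rewrite (asboolF AF) (asboolT BF) asboolT ?add0r//; right.
  - by rewrite (asboolF AF) (asboolF BF) asboolF ?addr0// => -[].
(* Coordinates are enumerated by codes of rationals. An index that codes none gets the dummy
   coordinate 0, and [X] uses only digits at codes. *)
pose x (n : nat) (F : set R) := `[< F (ratr (odflt (0 : rat) (unpickle n))) >].
pose X (q : rat) o := digit mu x (pickle q) (U o).
pose coord (q : rat) (F : set R) := `[< F (ratr q) >].
have fdd (s : seq rat) (A : pred (seq bool)) :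
    measurable [set o | A [seq X q o | q <- s]] /\
    P [set o | A [seq X q o | q <- s]] = (mu [set F | A [seq coord q F | q <- s]])%:E.
  (* One more than the largest code in [s], so that the first [n] digits determine the field on
     [s]. *)
  pose n := (\max_(q <- s) (pickle q).+1)%N.
  have sn q : q \in s -> (pickle q < n)%N by move=> qs; apply: (@leq_bigmax_seq _ _ xpredT).
  pose A' : pred (seq bool) := fun w => A [seq nth false w (pickle q) | q <- s].
  have [m1 P1] := digit_fdd mu_ge0 mu1 muU x mU PU A' n.
  have E1 : [set o | A [seq X q o | q <- s]] =
      [set o | A' (mkseq ((digit mu x)^~ (U o)) n)].
    apply/seteqP; split => o; rewrite /A' /=;
      rewrite (_ : [seq X q o | q <- s] =
        [seq nth false (mkseq ((digit mu x)^~ (U o)) n) (pickle q) | q <- s])//;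
      by apply/eq_in_map => q /sn qn; rewrite nth_mkseq.
  have E2 : [set F | A [seq coord q F | q <- s]] =
      [set F | A' (mkseq (x^~ F) n)].
    apply/seteqP; split => F; rewrite /A' /=;
      rewrite (_ : [seq coord q F | q <- s] =
        [seq nth false (mkseq (x^~ F) n) (pickle q) | q <- s])//;
      by apply/eq_in_map => q /sn qn; rewrite nth_mkseq// /x pickleK.
  by rewrite E2 E1.
exists X; split.
- by move=> s A; exact: (fdd s A).1.
- move=> t s A.
  have -> : [set o | A [seq X (q + t) o | q <- s]] =
      [set o | A [seq X q o | q <- [seq q + t | q <- s]]].
    by apply/seteqP; split => o /=; rewrite -map_comp.
  rewrite !(fdd _ A).2; congr EFin.
  rewrite /mu -(Eshift (ratr t) (ind [set F | A [seq coord q F | q <- s]]))//.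
  congr E; apply/funext => F; rewrite /ind; congr ((nat_of_bool _)%:R).
  apply: congr1; rewrite /= -map_comp; congr (is_true (A _)).
  by apply: eq_map => q; rewrite /coord /shift /= rmorphD.
- move=> y; have := (fdd [:: 0; - y] (fun w => nth false w 0 && nth false w 1)).2.
  rewrite /= => ->; congr EFin; rewrite -Epair; congr E; apply/funext => F.
  rewrite /ind /pair_ind; congr ((nat_of_bool _)%:R).
  apply: asbool_equiv_eq; rewrite /coord /= rmorph0 rmorphN.
  by split => [/andP[/asboolP ? /asboolP ?]|[? ?]] //; apply/andP; split; apply/asboolP.
Qed.

End rational_field.

(** * The closure of the field as a stationary random closed set *)

Section closure_of_field.
Context {d} {Omega : measurableType d} {R : realType}.
Variables (P : probability Omega R) (S2 : R -> R) (X : rat -> Omega -> bool).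
Hypothesis fieldX : rational_field P S2 X.
Implicit Types (G K : set R) (t q : rat).

Definition field_set (o : Omega) : set R :=
  closure [set (ratr q : R) | q in [set q | X q o]].

Let mX_seq := let: And3 H _ _ := fieldX in H.
Let PX_shift := let: And3 _ H _ := fieldX in H.

Lemma measurable_field q : measurable [set o | X q o].
Proof.
have := mX_seq [:: q] (fun w => head false w); congr measurable.
Qed.

Let touch G t : set Omega := [set o | exists q, X (q + t) o /\ G (ratr q)].

Let measurable_touch G t : measurable (touch G t).
Proof.
have -> : touch G t = \bigcup_(q in [set: rat]) [set o | X (q + t) o /\ G (ratr q)].
  by apply/seteqP; split => o; [move=> [q h]; exists q|move=> [q _ h]; exists q].
apply: countable_bigcupT_measurable => [|q]; first exact: countableP.
have [Gq|nGq] := pselect (G (ratr q)).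
  have := measurable_field (q + t); congr measurable.
  by apply/seteqP; split => o //= -[].
by rewrite (_ : [set _ | _] = set0)//; apply/seteqP; split => // o [].
Qed.

(** The event is the increasing union of events about finitely many rationals, whose probabilities
    are shift invariant by hypothesis. *)
Let P_touch G t : P (touch G t) = P (touch G 0).
Proof.
pose s n := [seq q <- [seq odflt (0 : rat) (unpickle i) | i <- iota 0 n] | `[< G (ratr q) >]].
pose F u n := [set o | has id [seq X (q + u) o | q <- s n]].
have FE u : touch G u = \bigcup_n F u n.
  apply/seteqP; split => o.
    move=> [q [Xq Gq]]; exists (pickle q).+1 => //; rewrite /F /= has_map; apply/hasP.
    exists q => //; rewrite mem_filter; apply/andP; split; first exact/asboolP.
    by apply/mapP; exists (pickle q); rewrite ?pickleK// mem_iota add0n/= ltnSn.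
  move=> [n _]; rewrite /F /= has_map => /hasP[q]; rewrite mem_filter.
  by move=> /andP[/asboolP Gq _] Xq; exists q.
have cvgF u : P \o F u @ \oo --> P (touch G u).
  rewrite FE; apply: nondecreasing_cvg_mu.
  - move=> n; have := mX_seq [seq q + u | q <- s n] (has id); congr measurable.
    by apply/seteqP; split => o; rewrite /F /= -map_comp.
  - by rewrite -FE; exact: measurable_touch.
  - move=> m n mn; apply/subsetPset => o; rewrite /F /= !has_map => /hasP[q].
    rewrite mem_filter => /andP[Gq /mapP[i im qi]] Xq; apply/hasP; exists q => //.
    rewrite mem_filter Gq; apply/mapP; exists i => //.
    by move: im; rewrite !mem_iota !add0n/= => im; exact: leq_trans im mn.
have PF : P \o F t = P \o F 0.
  by apply/funext => n /=; rewrite /F (PX_shift t (s n) (has id)) (PX_shift 0 (s n) (has id)).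
have cF := cvgF t; rewrite PF in cF.
exact: (cvg_unique _ cF (cvgF 0)).
Qed.

Definition thicken n K : set R := [set x | exists2 k, K k & `|x - k| < n.+1%:R^-1].

Let inv_nat_lt (e : R) : 0 < e -> exists n : nat, n.+1%:R^-1 < e.
Proof.
move=> e0; exists (Num.trunc e^-1).
by rewrite -[ltRHS]invrK ltf_pV2 ?posrE ?invr_gt0 ?ltr0n//; exact: truncnS_gt.
Qed.

(** If the closure misses [K], each point of [K] has a neighbourhood at positive distance from the
    field, and compactness makes this distance uniform, so a thin enough thickening contains no
    point of the field. *)
Lemma field_set_hit K o : compact K ->
  field_set o `&` K !=set0 <->
  forall n, exists q, X q o /\ thicken n K (ratr q).
Proof.
move=> cK; split=> [[k [Zk Kk]] n|H].
  have [|_ [[q Xq <-] qk]] := Zk (ball k n.+1%:R^-1).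
    by apply: nbhsx_ballx; rewrite invr_gt0.
  by exists q; split => //; exists k => //; rewrite distrC.
apply: contrapT => /set0P/negP; rewrite negbK => /eqP ZK0.
pose bad (n : nat) (k : R) := forall q, X q o -> n.+1%:R^-1 <= `|ratr q - k|.
have [N _ HN] : \forall n \near \oo, K `<=` bad n.
  apply: (proj1 (compact_near_coveringP K) cK) => k Kk.
  have nZk : (~` field_set o) k.
    by move=> Zk; have : (field_set o `&` K) k by []; rewrite ZK0.
  have : open (~` field_set o) by apply: closed_openC; exact: closed_closure.
  rewrite openE => /(_ _ nZk)[e /= e0 eZ].
  have e2 : 0 < e / 2 by lra.
  have [N Ne] := inv_nat_lt e2.
  exists (ball k (e / 2), [set n | (N <= n)%N]) => /=.
    by split; [exact: nbhsx_ballx|exists N].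
  move=> [x n] [/= kx Nn] q Xq; rewrite leNgt; apply/negP => qx.
  apply: (eZ (ratr q)); last by apply: subset_closure; exists q.
  have nN : n.+1%:R^-1 <= N.+1%:R^-1 :> R by rewrite lef_pV2 ?posrE ?ltr0n// ler_nat ltnS.
  move: kx; rewrite /ball/= => kx.
  rewrite (le_lt_trans (ler_distD x _ _))// [`|x - _|]distrC.
  by rewrite (splitr e) ltrD//; exact: lt_trans (lt_le_trans qx nN) Ne.
have [q [Xq [k Kk qk]]] := H N.
by have := HN N (leqnn N) k Kk q Xq; rewrite leNgt qk.
Qed.

Let touchE n K : [set o | exists q, X q o /\ thicken n K (ratr q)] = touch (thicken n K) 0.
Proof. by apply/seteqP; split => o /= [q h]; exists q; move: h; rewrite addr0. Qed.

Let hitE K : compact K ->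
  [set o | field_set o `&` K !=set0] = \bigcap_n touch (thicken n K) 0.
Proof.
move=> cK; apply/seteqP; split => o.
  by move=> /(field_set_hit _ cK) H n _; rewrite -touchE; exact: H.
by move=> H; apply/(field_set_hit _ cK) => n; have := H n I; rewrite -touchE.
Qed.

Lemma field_set_RACS : RACS field_set.
Proof.
split; first by move=> o; exact: closed_closure.
by move=> K cK; rewrite hitE//; apply: bigcapT_measurable => n.
Qed.

Let compact_shift (y : R) K : compact K -> compact [set k + y | k in K].
Proof.
move=> cK; apply: continuous_compact => //.
by apply: continuous_subspaceT => x; apply: cvgD; [exact: cvg_id|exact: cvg_cst].
Qed.

(** The rational shift invariance of the field passes to real shifts because
    hitting [K + y] forces hitting a rational translate of a thickening of [K]. *)
Let P_hit_shift (y : R) K : compact K ->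
  (P [set o | field_set o `&` [set (k + y)%R | k in K] !=set0] <=
   P [set o | field_set o `&` K !=set0])%E.
Proof.
move=> cK; have cKy := @compact_shift y _ cK.
have cvgK : (P \o (fun n => touch (thicken n K) 0)) n @[n --> \oo] -->
    P [set o | field_set o `&` K !=set0].
  rewrite hitE//; apply: nonincreasing_cvg_mu.
  - exact: le_lt_trans (probability_le1 P (measurable_touch _ _)) (ltry _).
  - by move=> n; exact: measurable_touch.
  - by apply: bigcapT_measurable => n; exact: measurable_touch.
  - move=> m n mn; apply/subsetPset => o [q [Xq [k Kk qk]]]; exists q; split => //.
    exists k => //; apply: lt_le_trans qk _.
    by rewrite lef_pV2 ?posrE ?ltr0n// ler_nat ltnS.
rewrite -(cvg_lim _ cvgK)//; apply: lime_ge; first by apply/cvg_ex; eexists; exact: cvgK.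
apply: nearW => n /=.
have [e [e0 eE]] : exists e : R, 0 < e /\ n.+1%:R^-1 = e.
  by exists n.+1%:R^-1; rewrite invr_gt0 ltr0n.
(* A field point within [e / 2] of [k + y], moved back by a rational [t] within [e / 2] of [y], is
   within [e] of [k]. *)
have [t] : exists t, ratr t \in `]y, y + e / 2[ by apply: rat_in_itvoo; lra.
rewrite in_itv/= => /andP[t1 t2].
rewrite -(P_touch (thicken n K) t); apply: le_measure; rewrite ?inE.
- exact: field_set_RACS.2.
- exact: measurable_touch.
move=> o [z [Zz [k Kk kz]]]; rewrite -kz in Zz.
have [|_ [[q Xq <-] qk]] := Zz (ball (k + y) (e / 2)).
  by apply: nbhsx_ballx; lra.
exists (q - t); rewrite subrK; split => //; exists k => //; rewrite eE.
move: qk; rewrite /ball/= rmorphB /= ltr_distl => /andP[q1 q2].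
by rewrite ltr_distl; apply/andP; split; lra.
Qed.

Let P_hit_shiftE (y : R) K : compact K ->
  P [set o | field_set o `&` [set k + y | k in K] !=set0] =
  P [set o | field_set o `&` K !=set0].
Proof.
move=> cK; apply/eqP; rewrite eq_le P_hit_shift//=.
have := @P_hit_shift (- y) _ (@compact_shift y _ cK).
rewrite (_ : [set k - y | k in [set k + y | k in K]] = K)//.
apply/seteqP; split => x; first by move=> [_ [k Kk <-] <-]; rewrite addrK.
by move=> Kx; exists (x + y); [exists x|rewrite addrK].
Qed.

(** Missing [K] and missing [K'] together mean missing their union, so the miss events form a
    pi-system generating the hit sigma-algebra; the two laws agree on it and hence, by a Dynkin
    argument, everywhere. *)
Lemma field_set_stationary : stationary P field_set.
Proof.
move=> y.
pose miss := [set [set F : set R | ~ (F `&` K !=set0)] | K in [set K : set R | compact K]].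
pose good (B : set (set R)) := [/\ measurable [set o | B (field_set o)],
  measurable [set o | B (translate y (field_set o))] &
  P [set o | B (field_set o)] = P [set o | B (translate y (field_set o))]].
suff sub : <<s miss >> `<=` good.
  move=> B fB; have [] // := sub B; move: B fB; apply: smallest_sub.
    exact: smallest_sigma_algebra.
  move=> _ [K cK <-].
  pose Y := g_sigma_algebraType miss.
  have := @measurableC _ Y [set F : set R | ~ (F `&` K !=set0)].
  rewrite (_ : ~` _ = [set F : set R | F `&` K !=set0]); last first.
    by apply/seteqP; split => F /=; [move/contrapT|move=> ? ?].
  by apply; apply: sub_sigma_algebra; exists K.
have missI : setI_closed miss.
  move=> _ _ [K cK <-] [K' cK' <-]; exists (K `|` K'); first exact: compactU.
  apply/seteqP; split => F /=.
    by move=> H; split => -[x [Fx Kx]]; apply: H; exists x; split => //; [left|right].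
  by move=> [H1 H2] [x [Fx [Kx|Kx]]]; [apply: H1|apply: H2]; exists x.
rewrite -(setI_closed_g_dynkin_g_sigma_algebra missI); apply: smallest_sub.
  split.
  - have e (f : Omega -> set R) : [set o | [set: set R] (f o)] = setT by apply/seteqP.
    by rewrite /good !e; split.
  - move=> B [m1 m2 PB]; split; [exact: measurableC m1|exact: measurableC m2|].
    have := probability_setC P m1; have := probability_setC P m2.
    by rewrite PB => <-.
  - move=> B tB gB.
    have e1 : [set o | (\bigcup_k B k) (field_set o)] = \bigcup_k [set o | B k (field_set o)].
      by apply/seteqP; split => o [k _ h]; exists k.
    have e2 : [set o | (\bigcup_k B k) (translate y (field_set o))] =
        \bigcup_k [set o | B k (translate y (field_set o))].
      by apply/seteqP; split => o [k _ h]; exists k.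
    have t1 (f : Omega -> set R) : trivIset setT (fun k => [set o | B k (f o)]).
      apply/trivIsetP => i j _ _ ij; move/trivIsetP : tB => /(_ i j I I ij) Bij.
      by apply/seteqP; split => // o [Bi Bj]; have : (B i `&` B j) (f o) by []; rewrite Bij.
    rewrite /good e1 e2; split.
    + by apply: bigcupT_measurable => k; have [] := gB k.
    + by apply: bigcupT_measurable => k; have [] := gB k.
    + rewrite !measure_semi_bigcup//.
      * by apply: eq_eseriesr => k _; have [] := gB k.
      * by move=> k; have [] := gB k.
      * by apply: bigcupT_measurable => k; have [] := gB k.
      * by move=> k; have [] := gB k.
      * by apply: bigcupT_measurable => k; have [] := gB k.
move=> _ [K cK <-].
have cKy := @compact_shift (- y) _ cK.
have e o : translate y (field_set o) `&` K !=set0 <->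
    field_set o `&` [set k - y | k in K] !=set0.
  split=> [[x [/translateE Zx Kx]]|[z [Zz [k Kk kz]]]].
    by exists (x - y); split => //; exists x.
  by exists k; split => //; apply/translateE; rewrite kz.
have eq2 : [set o | ~ (translate y (field_set o) `&` K !=set0)] =
    ~` [set o | field_set o `&` [set k - y | k in K] !=set0].
  by apply/seteqP; split => o /= nh h; apply: nh; apply/e.
have m1 := field_set_RACS.2 _ cK; have m2 := field_set_RACS.2 _ cKy.
split; first exact: measurableC m1.
  by rewrite /= eq2; exact: measurableC m2.
rewrite /= eq2; have := probability_setC P m1; have := probability_setC P m2.
by rewrite P_hit_shiftE// => -> <-.
Qed.

End closure_of_field.

(** * Variation of the field along grids of rationals, boundary points and covariogram *)

Lemma bool_change_between (f : nat -> bool) i j : (i <= j)%N -> f i != f j ->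
  exists2 k, (i <= k < j)%N & f k != f k.+1.
Proof.
move=> ij; rewrite -(subnKC ij); elim: (j - i)%N => [|n ih]; first by rewrite addn0 eqxx.
have [E|nE _] := eqVneq (f (i + n)%N) (f (i + n.+1)%N).
  rewrite -E => /ih[k /andP[ik kn] fk]; exists k => //.
  by rewrite ik (leq_trans kn)// leq_add2l.
by exists (i + n)%N; rewrite -?addnS// leq_addr addnS ltnSn.
Qed.

(** The denominator of [u] divides [m!] for all large [m], so a fixed rational belongs to all late
    grids. *)
Lemma rat_factorial (u : rat) : 0 <= u ->
  exists m0, forall m, (m0 <= m)%N -> exists i : nat, u * (m`!)%:R = i%:R.
Proof.
move=> u0; exists `|denq u|%N => m m0.
have /dvdnP[c mc] : (`|denq u|%N %| m`!)%N.
  by apply: dvdn_fact; rewrite m0 absz_gt0 denq_neq0.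
exists (`|numq u|%N * c)%N.
have dE : (`|denq u|%N)%:R = (denq u)%:~R :> rat by rewrite -[in RHS](gez0_abs (denq_ge0 u)).
have nE : (`|numq u|%N)%:R = (numq u)%:~R :> rat.
  by rewrite -[in RHS](gez0_abs (_ : 0 <= numq u)%R)// numq_ge0.
have uE : u * (denq u)%:~R = (numq u)%:~R.
  by rewrite -{1}[u]divq_num_den divfK ?intr_eq0 ?denq_neq0.
by rewrite mc !natrM dE mulrCA uE nE mulrC.
Qed.

Lemma common_radius {R : realType} {T : eqType} (s : seq T) (Q : T -> R -> Prop) :
  (forall x e e', Q x e -> e' <= e -> Q x e') ->
  (forall x, x \in s -> exists2 e, 0 < e & Q x e) ->
  exists2 e, 0 < e & forall x, x \in s -> Q x e.
Proof.
move=> mono; elim: s => [_|x s ih H]; first by exists 1.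
have [|e1 e10 Q1] := ih; first by move=> y ys; apply: H; rewrite inE ys orbT.
have [|e2 e20 Q2] := H x; first exact: mem_head.
exists (Num.min e1 e2); first by rewrite lt_min e10.
move=> y; rewrite inE => /predU1P[->|/Q1 h].
  by apply: mono Q2 _; rewrite ge_min lexx orbT.
by apply: mono h _; rewrite ge_min lexx.
Qed.

Section variation_of_field.
Context {d} {Omega : measurableType d} {R : realType}.
Variables (P : probability Omega R) (S2 : R -> R) (X : rat -> Omega -> bool).
Hypothesis fieldX : rational_field P S2 X.
Variable r : R.
Hypotheses (r0 : 0 < r) (lip : lipschitz_with (r / 2) S2).
Implicit Types (a b p q : rat).
Local Notation ZX := (@field_set d Omega R X).

Let PX_shift := let: And3 _ H _ := fieldX in H.
Let PX_pair := let: And3 _ _ H := fieldX in H.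
Let mX := measurable_field fieldX.

Let P_field q : P [set o | X q o] = (S2 0)%:E.
Proof.
have := PX_shift q [:: 0] (head false); rewrite /= add0r => ->.
have <- : S2 (ratr 0) = S2 0 by rewrite rmorph0.
rewrite -PX_pair.
by congr (P _); apply/seteqP; split => o /=; rewrite oppr0 andbb.
Qed.

Let change p q := [set o | X p o != X q o].

Let changeE p q : change p q =
  ([set o | X p o] `\` [set o | X q o]) `|` ([set o | X q o] `\` [set o | X p o]).
Proof.
apply/seteqP; split => o; rewrite /change /=; case: (X p o); case: (X q o) => //=.
- by left.
- by right.
- by case=> -[].
- by case=> -[].
Qed.

Let measurable_change p q : measurable (change p q).
Proof. by rewrite changeE; apply: measurableU; exact: measurableD. Qed.

(** The probability is twice [S2 0 - S2 (p - q)], which the Lipschitz constant [r / 2] bounds. *)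
Let P_change p q : (P (change p q) <= (r * `|ratr p - ratr q|)%:E)%E.
Proof.
rewrite changeE (@probability_symdiff _ _ _ P _ _ (S2 0) (S2 (ratr (p - q))))
  ?P_field//; last first.
  rewrite -PX_pair opprB.
  have := PX_shift p [:: 0; q - p] (fun w => nth false w 0 && nth false w 1).
  rewrite /= add0r subrK => <-; congr (P _).
  by apply/seteqP; split => o /=; [move=> [-> ->]|move=> /andP[]].
rewrite lee_fin; have := lip 0 (ratr (p - q)).
rewrite sub0r normrN rmorphB /= => h; have := le_trans (ler_norm _) h.
by lra.
Qed.

(** With [m!] cells, each rational of [a, b] is a grid point for all large [m], so changes are seen
    by the lower limit over [m]. *)
Let grid a b m (k : nat) : rat := a + (b - a) * (k%:R / (m`!)%:R).

Definition grid_variation a b m o : \bar R :=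
  (\sum_(k < m`!) (\1_(change (grid a b m k) (grid a b m k.+1)) o : R)%:E)%E.

Let integral_grid_variation a b m : a < b ->
  (\int[P]_o grid_variation a b m o <= (r * ratr (b - a))%:E)%E.
Proof.
move=> ab; rewrite ge0_integral_sum//; last first.
  by move=> k; apply/measurable_EFinP; exact/measurable_indicP.
have m0 : 0 < (m`!)%:R :> rat by rewrite ltr0n fact_gt0.
apply: (@le_trans _ _ (\sum_(k < m`!) (r * ratr (b - a) / (m`!)%:R)%:E)%E).
  apply: lee_sum => k _; rewrite integral_indic// setIT.
  apply: le_trans (P_change _ _) _; rewrite lee_fin -mulrA ler_pM2l//.
  rewrite -rmorphB /= /grid opprD addrACA subrr add0r -mulrBr -mulrBl -natr1.
  rewrite opprD addrA subrr sub0r mulN1r mulrN rmorphN normrN /= rmorphM /= fmorphV rmorph_nat.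
  by rewrite ger0_norm// divr_ge0// ler0q subr_ge0 ltW.
rewrite sumEFin lee_fin big_const_ord iter_addr_0 -[_ *+ m`!]mulr_natr.
by rewrite divfK// pnatr_eq0 -lt0n fact_gt0.
Qed.

Let integral_le_variation a b (g : Omega -> \bar R) : a < b ->
  (forall o, 0 <= g o)%E -> (forall o, g o <= limn_einf (grid_variation a b ^~ o))%E ->
  (\int[P]_o g o <= (r * ratr (b - a))%:E)%E.
Proof.
move=> ab g0 gle; apply: le_trans (le_integral_pointwise P g0 gle) _.
apply: le_trans (fatou _ _ _ _) _ => //.
- move=> m; apply: emeasurable_sum => k.
  by apply/measurable_EFinP; exact/measurable_indicP.
- by move=> m o _; apply: sume_ge0 => k _; rewrite lee_fin.
by apply: limn_einf_le => m; exact: integral_grid_variation.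
Qed.

(** Once [p] and [q] are both grid points, a field differing at them changes across some cell
    between them. *)
Let grid_change a b p q o : a < b -> a <= p <= b -> a <= q <= b ->
  X p o != X q o -> exists m0, forall m, (m0 <= m)%N ->
  exists2 k, (k < m`!)%N & change (grid a b m k) (grid a b m k.+1) o /\
    Num.min p q <= grid a b m k <= Num.max p q.
Proof.
move=> ab; wlog pq : p q / p < q.
  move=> H pab qab Xpq; have [|qp|E] := ltgtP p q.
  - by move=> pq; have := H p q pq pab qab Xpq; rewrite (min_idPl (ltW pq)) (max_idPr (ltW pq)).
  - rewrite eq_sym in Xpq; have := H q p qp qab pab Xpq.
    by rewrite (min_idPl (ltW qp)) (max_idPr (ltW qp)).
  - by rewrite E eqxx in Xpq.
move=> /andP[ap pb] /andP[aq qb] Xpq; rewrite (min_idPl (ltW pq)) (max_idPr (ltW pq)).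
have ba0 : 0 < b - a by rewrite subr_gt0.
have [|m1 H1] := @rat_factorial ((p - a) / (b - a)).
  by rewrite divr_ge0 ?subr_ge0// ltW.
have [|m2 H2] := @rat_factorial ((q - a) / (b - a)).
  by rewrite divr_ge0 ?subr_ge0// ltW.
exists (maxn m1 m2) => m; rewrite geq_max => /andP[/H1[i iE] /H2[j jE]].
have m0 : 0 < (m`!)%:R :> rat by rewrite ltr0n fact_gt0.
have gp : grid a b m i = p.
  by rewrite /grid -iE mulfK ?gt_eqF// mulrC divfK ?gt_eqF// addrC subrK.
have gq : grid a b m j = q.
  by rewrite /grid -jE mulfK ?gt_eqF// mulrC divfK ?gt_eqF// addrC subrK.
have grid_le k l : (grid a b m k <= grid a b m l) = (k <= l)%N.
  by rewrite /grid lerD2l ler_pM2l// ler_pM2r ?invr_gt0// ler_nat.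
have ij : (i <= j)%N by rewrite -grid_le gp gq ltW.
have jm : (j <= m`!)%N.
  by rewrite -grid_le gq /grid divff ?gt_eqF// mulr1 addrC subrK.
have [|k /andP[ik kj] ck] := @bool_change_between (fun k => X (grid a b m k) o) i j ij.
  by rewrite gp gq.
exists k; first exact: leq_trans kj jm.
by split => //; rewrite -{1}gp -gq !grid_le ik ltnW.
Qed.

(** Here the closure adds a rational that the field excludes; such events must be shown null. *)
Let isolated q := [set o | ZX o (ratr q) /\ ~~ X q o].

Let measurable_isolated q : measurable (isolated q).
Proof.
apply: measurableI; first exact: RACS_measurable_point (field_set_RACS fieldX) _.
have := measurableC (mX q); congr measurable.
by apply/seteqP; split => o /= /negP.
Qed.

(** On this event the field has a point arbitrarily close to [q], hence changes within [c] of [q].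
    The expected variation there is at most [2 r c], and [c] is taken below [e / (2 r)]. *)
Let P_isolated q : P (isolated q) = 0%E.
Proof.
apply/eqP; rewrite eq_le measure_ge0 andbT; apply/lee_addgt0Pr => e e0; rewrite add0e.
have [c] : exists c, ratr c \in `]0, e / (2 * r)[.
  by apply: rat_in_itvoo; rewrite divr_gt0// mulr_gt0.
rewrite in_itv/= ltr0q => /andP[c0 ce].
have cab : q - c < q + c by rewrite ltrD2l; lra.
apply: (@le_trans _ _ (r * ratr ((q + c) - (q - c)))%:E); last first.
  rewrite (_ : q + c - (q - c) = 2 * c); last by ring.
  rewrite lee_fin rmorphM /= rmorph_nat.
  by move: ce; rewrite ltr_pdivlMr ?mulr_gt0//; lra.
rewrite -[X in (P X <= _)%E]setIT -integral_indic//.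
apply: integral_le_variation => //.
move=> o; apply: limn_einf_ge.
have [[Zq nXq]|nE] := pselect (isolated q o); last first.
  apply: nearW => m; rewrite indicE memNset//.
  by apply: sume_ge0 => k _; rewrite lee_fin.
have c0' : 0 < ratr c :> R by rewrite ltr0q.
have [_ [[p Xp <-] qp]] := Zq _ (nbhsx_ballx (ratr q : R) _ c0').
have : `|ratr q - ratr p| < ratr c :> R by exact: qp.
rewrite ltr_distl => /andP[h1 h2].
have p1 : q - c < p by rewrite -(ltr_rat R) rmorphB /=; lra.
have p2 : p < q + c by rewrite -(ltr_rat R) rmorphD /=; lra.
have [|||m0 H] := @grid_change (q - c) (q + c) p q o cab.
- by apply/andP; split; lra.
- by apply/andP; split; lra.
- by rewrite Xp (negbTE nXq).
exists m0 => // m /= /H[k km [ck _]].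
rewrite indicE; apply: (@le_trans _ _ 1%E); first by rewrite lee_fin; case: (_ \in _).
rewrite /grid_variation (bigD1 (Ordinal km))//= indicE mem_set//.
by rewrite leeDl//; apply: sume_ge0 => l _; rewrite lee_fin.
Qed.

Lemma field_set_boundary_neighbours o (z e : R) : 0 < e -> boundary (ZX o) z ->
  exists p q, [/\ `|ratr p - z| < e, `|ratr q - z| < e & X p o != X q o].
Proof.
move=> e0; rewrite boundaryE => -[Zz nZz].
have [x []] := nZz _ (nbhsx_ballx z _ e0).
have cZ : closed (ZX o) by exact: closed_closure.
have Zz' : ZX o z by rewrite ((closure_id _).1 cZ).
move=> nZx zx.
have [_ [[p Xp <-] zp]] := Zz' _ (nbhsx_ballx z _ e0).
have : open (~` ZX o) by apply: closed_openC; exact: closed_closure.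
rewrite openE => /(_ _ nZx)[e' /= e'0 e'Z].
(* This radius keeps the rational [q] both in the ball missed by the closure and within [e] of
   [z]. *)
pose t := Num.min e' (e - `|z - x|).
have t0 : 0 < t by rewrite lt_min e'0 subr_gt0.
have [q] : exists q, ratr q \in `]x, x + t[ by apply: rat_in_itvoo; lra.
rewrite in_itv/= => /andP[q1 q2].
have qx : `|x - ratr q| < t by rewrite ltr_distlC; apply/andP; split; lra.
have nXq : ~~ X q o.
  apply/negP => Xq; apply: (e'Z (ratr q)); last by apply: subset_closure; exists q.
  by apply: lt_le_trans qx _; rewrite ge_min lexx.
exists p, q; split; [by rewrite distrC| |by rewrite Xp (negbTE nXq)].
rewrite distrC (le_lt_trans (ler_distD x _ _))//.
have : t <= e - `|z - x| by rewrite ge_min lexx orbT.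
by lra.
Qed.

(** Any finite set of boundary points is charged injectively to changes along every fine enough
    grid, so their number is below the lower limit of the grid variation. *)
Lemma field_set_boundary_count :
  (\int[P]_o counting (boundary (ZX o) `&` `]0%R, 1%R[) <= r%:E)%E.
Proof.
have -> : r%:E = (r * ratr (1 - 0 : rat))%:E by rewrite subr0 rmorph1 mulr1.
apply: integral_le_variation => // o.
apply: counting_le => s us sA; apply: limn_einf_ge.
(* The points of [s] are [2 e] apart and at least [e] from 0 and 1: grid points within [e] of
   different boundary points are then different, and rationals within [e] of them stay in [0, 1]. *)
have [e e0 sep] : exists2 e : R, 0 < e & forall x, x \in s ->
    (e <= x /\ x <= 1 - e) /\ forall y, y \in s -> x != y -> 2 * e <= `|x - y|.
  apply: common_radius => [x e e' [[h1 h2] h3] ee'|x xs].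
    split; first by split; lra.
    by move=> y ys xy; apply: le_trans (h3 y ys xy); lra.
  have [_] := sA _ xs; rewrite /= in_itv/= => /andP[x0 x1].
  have [e e0 He] : exists2 e : R, 0 < e & forall y, y \in s -> x != y -> 2 * e <= `|x - y|.
    apply: (@common_radius R R s (fun y e => x != y -> 2 * e <= `|x - y|)).
      by move=> y e e' h ee' xy; have := h xy; lra.
    move=> y _; have [->|xy] := eqVneq x y; first by exists 1.
    exists (`|x - y| / 2); last by move=> _; lra.
    by rewrite divr_gt0// normr_gt0 subr_eq0.
  exists (Num.min e (Num.min x (1 - x))); first by rewrite !lt_min e0 x0 subr_gt0.
  split.
    have : Num.min e (Num.min x (1 - x)) <= x by rewrite !ge_min lexx orbT.
    have : Num.min e (Num.min x (1 - x)) <= 1 - x by rewrite !ge_min lexx !orbT.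
    by split; lra.
  move=> y ys xy; apply: le_trans (He y ys xy).
  by rewrite ler_pM2l// ge_min lexx.
have [M HM] : exists M, forall z, z \in s -> forall m, (M <= m)%N ->
    exists2 k, (k < m`!)%N & change (grid 0 1 m k) (grid 0 1 m k.+1) o /\
      `|ratr (grid 0 1 m k) - z| < e.
  have {}H z : z \in s -> exists M, forall m, (M <= m)%N ->
    exists2 k, (k < m`!)%N & change (grid 0 1 m k) (grid 0 1 m k.+1) o /\
      `|ratr (grid 0 1 m k) - z| < e.
    move=> zs; have [[ze1 ze2] _] := sep z zs.
    have [p [q [pz qz Xpq]]] := field_set_boundary_neighbours e0 (sA z zs).1.
    have in01 (t : rat) : `|ratr t - z| < e -> 0 <= t <= 1.
      rewrite ltr_distl => /andP[t1 t2].
      by rewrite -!(ler_rat R) rmorph0 rmorph1; apply/andP; split; lra.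
    have [m0 Hm] := grid_change (ltr01 : 0 < 1 :> rat) (in01 p pz) (in01 q qz) Xpq.
    exists m0 => m /Hm[k km [ck /andP[g1 g2]]]; exists k => //; split => //.
    move: pz qz; rewrite !ltr_distl => /andP[p1 p2] /andP[q1 q2].
    move: g1 g2; rewrite ge_min le_max -!(ler_rat R).
    by case/orP=> g1; case/orP=> g2; apply/andP; split; lra.
  elim: s {us sA sep} H => [_|z s ih H]; first by exists 0%N.
  have [|M1 H1] := ih; first by move=> y ys; apply: H; rewrite inE ys orbT.
  have [|M2 H2] := H z; first exact: mem_head.
  exists (maxn M1 M2) => y; rewrite inE => /predU1P[->|ys] m; rewrite geq_max => /andP[m1 m2].
    exact: H2.
  exact: H1.
exists M => // m /= Mm; rewrite /grid_variation.
rewrite (sum_indic_size (fun k => change (grid 0 1 m k) (grid 0 1 m k.+1))).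
have cho z : exists k, z \in s -> [/\ (k < m`!)%N,
    change (grid 0 1 m k) (grid 0 1 m k.+1) o & `|ratr (grid 0 1 m k) - z| < e].
  have [zs|_] := boolP (z \in s); last by exists 0%N.
  by have [k km [ck gk]] := HM z zs m Mm; exists k.
pose k z := sval (cid (cho z)).
have kP z : z \in s -> [/\ (k z < m`!)%N,
    change (grid 0 1 m (k z)) (grid 0 1 m (k z).+1) o & `|ratr (grid 0 1 m (k z)) - z| < e].
  by rewrite /k; case: cid.
rewrite lee_fin ler_nat -(size_map k); apply: uniq_leq_size.
  rewrite map_inj_in_uniq// => z z' zs z's kk; apply: contrapT => /eqP zz'.
  have [_ _ h1] := kP z zs; have [_ _ h2] := kP z' z's.
  have := (sep z zs).2 z' z's zz'; rewrite leNgt => /negP; apply.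
  rewrite (le_lt_trans (ler_distD (ratr (grid 0 1 m (k z))) _ _))// kk.
  by rewrite -kk distrC; rewrite -kk in h2; lra.
move=> _ /mapP[z zs ->]; have [km ck _] := kP z zs.
rewrite mem_filter; apply/andP; split; first exact/asboolP.
by rewrite mem_iota add0n km.
Qed.

Let P_pair_event (p q : rat) :
  P (pair_event ZX (ratr p) (ratr q)) =
  P [set o | X p o && X q o].
Proof.
have racsZ := field_set_RACS fieldX.
have mA := measurable_pair_event racsZ (ratr p) (ratr q).
have mB : measurable [set o | X p o && X q o].
  have -> : [set o | X p o && X q o] = [set o | X p o] `&` [set o | X q o].
    by apply/seteqP; split => o /=; [move=> /andP[]|move=> [-> ->]].
  exact: measurableI.
have inZ t o : X t o -> ZX o (ratr t).
  by move=> Xt; apply: subset_closure; exists t.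
apply/eqP; rewrite eq_le; apply/andP; split; last first.
  by apply: le_measure; rewrite ?inE// => o /andP[/inZ ? /inZ ?].
have sub : pair_event ZX (ratr p) (ratr q) `<=`
    [set o | X p o && X q o] `|` (isolated p `|` isolated q).
  move=> o [Zp Zq]; have [Xp|nXp] := boolP (X p o); last by right; left.
  by have [Xq|nXq] := boolP (X q o); [left; rewrite /= Xp Xq|right; right].
have mN : measurable (isolated p `|` isolated q) by exact: measurableU.
apply: (@le_trans _ _ (P ([set o | X p o && X q o] `|` (isolated p `|` isolated q)))).
  by apply: le_measure; rewrite ?inE//; exact: measurableU.
apply: le_trans (measureU2 _ mB mN) _; rewrite -[leRHS]adde0; apply: leeD => //.
apply: le_trans (measureU2 _ (measurable_isolated p) (measurable_isolated q)) _.
have le0 t : (P (isolated t) <= 0)%E by rewrite P_isolated.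
by rewrite -[leRHS]adde0; exact: leeD (le0 p) (le0 q).
Qed.

Lemma field_set_covariogram y :
  specific_covariogram P ZX y = (S2 y)%:E.
Proof.
pose Z := ZX.
have racsZ : RACS Z := field_set_RACS fieldX.
have statZ : stationary P Z := field_set_stationary fieldX.
(* [T2] is the covariogram that [Z] really has. The direct implication, applied to [Z], makes it
   Lipschitz, and it agrees with [S2] on the rationals because isolated points are null. *)
pose T2 y := fine (P (pair_event Z 0 (- y))).
have covZ u : specific_covariogram P Z u = (T2 u)%:E.
  rewrite /specific_covariogram integral_cov_window//.
  rewrite lebesgue_measure_itv/= lte_fin ltr01 -EFinB subr0 mule1 fineK//.
  by rewrite fin_num_measure//; exact: measurable_pair_event.
have lipT := covariogram_lipschitz racsZ statZ covZ r0 field_set_boundary_count.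
have ratT (q : rat) : T2 (ratr q) = S2 (ratr q).
  rewrite /T2; have := P_pair_event 0 (- q); rewrite rmorph0 rmorphN /= => ->.
  by rewrite PX_pair.
rewrite -/Z covZ; congr EFin; apply/eqP; rewrite -subr_eq0 -normr_le0.
apply/ler_addgt0Pr => e e0; rewrite add0r.
(* The two Lipschitz bounds with constant [r / 2] add up to [r] times the distance from [y] to [q],
   which is at most [e]. *)
have [q] : exists q, ratr q \in `]y, y + e / r[.
  by apply: rat_in_itvoo; rewrite ltrDl divr_gt0.
rewrite in_itv/= => /andP[q1 q2].
have h : r * `|y - ratr q| <= e.
  by rewrite distrC gtr0_norm ?subr_gt0// mulrC -ler_pdivlMr//; lra.
have h1 := lipT y (ratr q); have h2 := lip (ratr q) y.
rewrite (le_trans (ler_distD (S2 (ratr q)) _ _))// -{1}ratT.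
by rewrite distrC [`|ratr q - y|]distrC in h2; rewrite [`|S2 _ - S2 y|]distrC; lra.
Qed.

End variation_of_field.

Theorem theorem4p12 (R : realType) (d : measure_display) (Omega : measurableType d)
  (P : probability Omega R)
  (Hcomplete : complete_prob P) (Hrich : carries_uniform P)
  (S2 : R -> R) (r : R) (hr : 0 < r) :
  (exists Z : Omega -> set R,
      RACS Z /\ stationary P Z /\
      (forall y : R, specific_covariogram P Z y = (S2 y)%:E) /\
      (\int[P]_w counting (boundary (Z w) `&` `]0%R, 1%R[) <= r%:E)%E)
  <->
  (F_scov_admissible S2 /\ exists L : R, L <= r / 2 /\ lipschitz_with L S2).
Proof.
split=> [[Z [racsZ [statZ [covZ bdZ]]]]|[adm [L [Lr lipL]]]].
  split; first exact: covariogram_admissible racsZ statZ _ covZ.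
  exists (r / 2); split => //.
  exact: covariogram_lipschitz racsZ statZ _ covZ r hr bdZ.
have lip : lipschitz_with (r / 2) S2.
  by move=> x y; apply: le_trans (lipL x y) _; rewrite ler_wpM2r.
have [X fieldX] := rational_field_exists Hrich adm.
exists (field_set X); split; first exact: field_set_RACS fieldX.
split; first exact: field_set_stationary fieldX.
split; first exact: field_set_covariogram fieldX _ hr lip.
exact: field_set_boundary_count fieldX _ hr lip.
Qed.
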